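(* Let $\Delta$ be a partitionable simplicial complex whose face poset is semi-Eulerian. Then (the face poset of) $\Delta$ is $SE$-partitionable.
   Context: **Posets.** All posets are finite and graded, with a minimum $\hat 0$ of rank $0$ and a maximum $\hat 1$; ''rank $d+1$'' means $\hat 1$ has rank $d+1$, and coatoms are the elements of rank $d$. A lower set of faces (for instance $\Gamma_\sigma$, $\partial\Gamma_\sigma$, $\partial\overline\sigma$ below) is regarded as such a poset by adjoining a maximum $\hat 1$; in particular $\{\emptyset\}$ denotes the rank-one poset $\{\hat0<\hat1\}$. The face poset of a finite simplicial complex consists of its faces (with $\emptyset$ as $\hat 0$) ordered by inclusion and an adjoined $\hat 1$; the complex is identified with its face poset. For an element $p$, $\overline p=[\hat 0,p]$; for a set $\mathcal C$ of elements, $\overline{\mathcal C}=\bigcup_{p\in\mathcal C}\overline p$; and $\partial\overline\sigma=\overline\sigma\setminus\{\sigma\}$. A poset is Eulerian if every interval $[x,y]$ with $x<y$ has as many elements of even rank as of odd rank; it is semi-Eulerian if this holds for every interval $[x,y]\ne[\hat0,\hat1]$ with $x<y$. It is near-Eulerian if it is obtained from an Eulerian poset by deleting a single coatom. For a near-Eulerian poset $\Gamma$, its boundary $\partial\Gamma$ is the closure of the set of all $y$ such that $[y,\hat1]$ is a three-element chain, and its semisuspension $\tilde\Sigma\Gamma$ is the Eulerian poset obtained from $\Gamma$ by adjoining a new coatom $\tau$ covering exactly all $y$ such that $[y,\hat 1]$ is a three-element chain. **Partitionable simplicial complexes.** A simplicial complex with facets $\sigma_1,\dots,\sigma_t$ is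 partitionable if its set of faces (including $\emptyset$) can be partitioned into Boolean intervals $[R_i,\sigma_i]=\{F:R_i\subseteq F\subseteq\sigma_i\}$, $i=1,\dots,t$, where $R_i$ is a face contained in $\sigma_i$. **$S$-partitionable posets** (recursive definition). An Eulerian poset $\Omega$ of rank $d+1$ is $S$-partitionable if either $\Omega=\{\emptyset\}$, or $\Omega$ has rank at least $2$ and there is a partition of $\Omega\setminus\{\hat 1\}$ with one class $P_\sigma\subseteq\overline\sigma$ for each coatom $\sigma$ (an $S$-partition) such that, writing $\Gamma_\sigma=\overline{P_\sigma\setminus\{\sigma\}}$: (a) there is a unique initial coatom $\sigma_1$ with $P_{\sigma_1}=\overline{\sigma_1}$, and $P_{\sigma_1}\setminus\{\sigma_1\}=\partial\overline{\sigma_1}$ is $S$-partitionable of rank $d$; (b) there is a unique terminal coatom $\sigma_t$ with $P_{\sigma_t}=\{\sigma_t\}$; (c) for every other coatom $\sigma$ (called ordinary), $\Gamma_\sigma$ is near-Eulerian of rank $d$, $\Gamma_\sigma=(P_\sigma\setminus\{\sigma\})\uplus\partial\Gamma_\sigma$ (disjoint union), and $\tilde\Sigma\Gamma_\sigma$ is $S$-partitionable of rank $d$ via an $S$-partition whose initial coatom is the added coatom $\tau_\sigma$. **$SE$-partitionable posets.** A semi-Eulerian poset $\Omega$ of rank $d+1$ is $SE$-partitionable if either $\Omega=\{\emptyset\}$, or $\Omega$ has rank at least $2$ and there is a partition of $\Omega\setminus\{\hat1\}$ with one class $P_\sigma\subseteq\overline\sigma$ for each coatom $\sigma$ (an $SE$-partition)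 such that: (a) there is a unique initial coatom $\sigma_1$ with $P_{\sigma_1}=\overline{\sigma_1}$, and $P_{\sigma_1}\setminus\{\sigma_1\}=\partial\overline{\sigma_1}$ is $S$-partitionable of rank $d$; (b) for every other coatom $\sigma$, either $P_\sigma=\{\sigma\}$, or $P_\sigma\setminus\{\sigma\}$ admits a partition into $k_\sigma\ge1$ disjoint sub-classes $P_\sigma^j$ such that each $\Gamma_\sigma^j=\overline{P_\sigma^j}$ is near-Eulerian of rank $d$, $\Gamma_\sigma^j=P_\sigma^j\uplus\partial\Gamma_\sigma^j$ (disjoint union), and $\tilde\Sigma\Gamma_\sigma^j$ is $S$-partitionable of rank $d$ via an $S$-partition whose initial coatom is the added coatom $\tau_\sigma^j$. *)

(* Defs.v *)
From HB Require Import structures.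
From mathcomp Require Import all_boot all_order.

Set Implicit Arguments.
Unset Strict Implicit.
Unset Printing Implicit Defensive.

Import Order.TTheory.
Local Open Scope order_scope.

Section Posets.
Context {disp : Order.disp_t} {T : finTPOrderType disp}.
Implicit Types (x y z s : T) (C : {set T}).

Definition interval x y : {set T} := [set z | x <= z <= y].

Definition is_chain C : bool :=
  [forall x in C, forall y in C, (x <= y) || (y <= x)].

(* The rank of [x] is the length of a longest chain ending at [x]. *)
Definition rank x : nat :=
  \max_(C : {set T} | is_chain C && [forall z in C, z < x]) #|C|.

Definition covers x y : bool := (x < y) && [forall z, ~~ (x < z < y)].

Definition coatom s : bool := (rank s).+1 == rank (\top : T).

Definition down s : {set T} := [set x | x <= s].

Definition bdown s : {set T} := down s :\ s.

Definition lower_closure C : {set T} := [set x | [exists p in C, x <= p]].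

Definition balanced x y : bool :=
  #|[set z in interval x y | odd (rank z)]|
    == #|[set z in interval x y | ~~ odd (rank z)]|.

(* The elements [y] for which [[y, \top]] has three elements; such an interval
   is automatically a chain. *)
Definition subcoatoms : {set T} := [set y | #|interval y \top| == 3%N].

Definition boundary : {set T} := lower_closure subcoatoms.

(* One class [P s] for each coatom [s]; the values of [P] at elements that are
   not coatoms are irrelevant. *)
Definition coatom_partition (P : T -> {set T}) : Prop :=
  [/\ forall s, coatom s -> P s \subset down s,
      forall s t, coatom s -> coatom t -> s != t -> [disjoint P s & P t]
    & \bigcup_(s | coatom s) P s = [set~ \top]].

End Posets.

Definition poset_rank {disp : Order.disp_t} (T : finTPOrderType disp) : nat :=
  rank (\top : T).

Definition graded {disp : Order.disp_t} (T : finTPOrderType disp) : Prop :=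
  (exists b : T, forall x, b <= x) /\
  (forall x y : T, covers x y -> rank y = (rank x).+1).

Definition eulerian {disp : Order.disp_t} (T : finTPOrderType disp) : Prop :=
  graded T /\ (forall x y : T, x < y -> balanced x y).

Definition semi_eulerian {disp : Order.disp_t} (T : finTPOrderType disp)
    : Prop :=
  graded T /\
  (forall x y : T, x < y -> interval x y != [set: T] -> balanced x y).

(* [T] is isomorphic, via [f], to [E] with the coatom [c] deleted. *)
Definition near_eulerian {disp : Order.disp_t} (T : finTPOrderType disp)
    : Prop :=
  graded T /\
  exists (E : finTPOrderType disp) (c : E) (f : T -> E),
    [/\ eulerian E, coatom c, {mono f : x y / x <= y}
      & forall e : E, (e \in codom f) = (e != c)].

(* The subposet [A] of [T] with a new maximum, namely [None], adjoined. *)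
Definition adjoin_top {disp : Order.disp_t} {T : finPOrderType disp}
  (A : {set T}) : Type := option {x : T | x \in A}.

Section AdjoinTop.
Context {disp : Order.disp_t} {T : finPOrderType disp} (A : {set T}).

Definition adjoin_top_le (u v : adjoin_top A) : bool :=
  match u, v with
  | Some x, Some y => val x <= val y
  | _, None => true
  | None, Some _ => false
  end.

Fact adjoin_top_le_refl : reflexive adjoin_top_le.
Proof. by case=> //= x. Qed.

Fact adjoin_top_le_anti : antisymmetric adjoin_top_le.
Proof.
by move=> [x|] [y|] //= /le_anti /val_inj ->.
Qed.

Fact adjoin_top_le_trans : transitive adjoin_top_le.
Proof. by move=> [y|] [x|] [z|] //=; apply: le_trans. Qed.

HB.instance Definition _ := Finite.copy (adjoin_top A) (option {x : T | x \in A}).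
HB.instance Definition _ := Order.Le_isPOrder.Build disp (adjoin_top A)
  adjoin_top_le_refl adjoin_top_le_anti adjoin_top_le_trans.

Fact adjoin_top_lex1 (u : adjoin_top A) : u <= (None : adjoin_top A).
Proof. by case: u. Qed.

HB.instance Definition _ := Order.hasTop.Build disp (adjoin_top A) adjoin_top_lex1.

(* The elements of [T] underlying a set of elements of [adjoin_top A]. *)
Definition faces (X : {set adjoin_top A}) : {set T} :=
  [set x | [exists y : {x : T | x \in A},
              ((Some y : adjoin_top A) \in X) && (val y == x)]].

End AdjoinTop.

(* [T] with a new element [None], lying below [\top] and above exactly the
   elements of [lower_closure subcoatoms]; as [subcoatoms] is an antichain, its
   members are exactly the elements covered by [None]. *)
Definition semisuspension {disp : Order.disp_t} (T : finTPOrderType disp)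
  : Type := option T.

Section Semisuspension.
Context {disp : Order.disp_t} (T : finTPOrderType disp).

Definition semisuspension_le (u v : semisuspension T) : bool :=
  match u, v with
  | Some x, Some y => x <= y
  | Some x, None => x \in lower_closure subcoatoms
  | None, Some y => y == \top
  | None, None => true
  end.

Fact top_notin_closure : (\top : T) \in lower_closure subcoatoms = false.
Proof.
apply/negP; rewrite inE => /existsP[p]; rewrite inE le1x.
case/andP=> + /eqP pT.
suff -> : interval p \top = [set p] by rewrite cards1.
by apply/setP=> z; rewrite !inE pT lex1 andbT le1x.
Qed.

Fact semisuspension_le_refl : reflexive semisuspension_le.
Proof. by case=> //= x. Qed.

Fact semisuspension_le_anti : antisymmetric semisuspension_le.
Proof.
move=> [x|] [y|] //=; first by move=> /le_anti ->.
- by case/andP=> /[swap] /eqP->; rewrite top_notin_closure.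
- by case/andP=> /eqP->; rewrite top_notin_closure.
Qed.

Fact semisuspension_le_trans : transitive semisuspension_le.
Proof.
move=> [y|] [x|] [z|] //=.
- exact: le_trans.
- move=> xy; rewrite !inE => /existsP[p /andP[pS yp]].
  by apply/existsP; exists p; rewrite pS (le_trans xy yp).
- by move=> /eqP->; rewrite le1x.
- by move=> xS /eqP->; rewrite lex1.
Qed.

HB.instance Definition _ := Finite.copy (semisuspension T) (option T).
HB.instance Definition _ := Order.Le_isPOrder.Build disp (semisuspension T)
  semisuspension_le_refl semisuspension_le_anti semisuspension_le_trans.

Fact semisuspension_lex1 (u : semisuspension T) :
  u <= (Some \top : semisuspension T).
Proof. by case: u => [x|]; [exact: (lex1 x)|exact: (eqxx (\top : T))]. Qed.

HB.instance Definition _ :=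
  Order.hasTop.Build disp (semisuspension T) semisuspension_lex1.

Definition added_coatom : semisuspension T := None.

End Semisuspension.

Arguments added_coatom {disp T}.

(* The conditions on a class [C] (playing the role of P_sigma \ {sigma}, or of
   one of its sub-classes) that do not involve S-partitionability. *)
Definition near_eulerian_class {disp : Order.disp_t} {T : finTPOrderType disp}
    (d : nat) (C : {set T}) : Prop :=
  let G : finTPOrderType disp := adjoin_top (lower_closure C) in
  [/\ near_eulerian G, poset_rank G = d,
      lower_closure C = C :|: faces (boundary : {set G})
    & [disjoint C & faces (boundary : {set G})]].

(* [S_partition P s1]: [P] is an S-partition of [T], with initial coatom [s1]. *)
Inductive S_partitionable {disp : Order.disp_t} : finTPOrderType disp -> Prop :=
  | S_partitionable_point (T : finTPOrderType disp) of
      eulerian T & poset_rank T = 1%N : S_partitionable T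
  | S_partitionable_step (T : finTPOrderType disp) (P : T -> {set T}) (s1 : T)
      of S_partition P s1 : S_partitionable T

with S_partition {disp : Order.disp_t}
    : forall T : finTPOrderType disp, (T -> {set T}) -> T -> Prop :=
  | S_partition_intro (T : finTPOrderType disp) (P : T -> {set T}) (s1 : T)
      (d : nat) (st : T) of
      eulerian T & poset_rank T = d.+1 & (0 < d)%N & coatom_partition P
    & unique (fun s => coatom s /\ P s = down s) s1
    & S_partitionable (adjoin_top (bdown s1))
    & poset_rank (adjoin_top (bdown s1)) = d
    & unique (fun s => coatom s /\ P s = [set s]) st
    & (forall s, coatom s -> s != s1 -> s != st ->
         let G : finTPOrderType disp := adjoin_top (lower_closure (P s :\ s)) in
         [/\ near_eulerian_class d (P s :\ s),
             poset_rank (semisuspension G) = d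
           & exists Q : semisuspension G -> {set semisuspension G},
               @S_partition disp (semisuspension G) Q added_coatom])
    : S_partition P s1.

Definition SE_partition {disp : Order.disp_t} {T : finTPOrderType disp}
    (P : T -> {set T}) : Prop :=
  exists (d : nat) (s1 : T),
    [/\ poset_rank T = d.+1, (0 < d)%N, coatom_partition P,
        [/\ unique (fun s => coatom s /\ P s = down s) s1,
            S_partitionable (adjoin_top (bdown s1))
          & poset_rank (adjoin_top (bdown s1)) = d]
      & forall s, coatom s -> s != s1 ->
          P s = [set s] \/
          exists Cs : {set {set T}},
            [/\ partition Cs (P s :\ s), Cs != set0
              & forall C, C \in Cs ->
                  let G : finTPOrderType disp := adjoin_top (lower_closure C) in
                  [/\ near_eulerian_class d C,
                      poset_rank (semisuspension G) = d
                    & exists Q : semisuspension G -> {set semisuspension G},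
                        S_partition Q added_coatom]]].

Definition SE_partitionable {disp : Order.disp_t} (T : finTPOrderType disp)
    : Prop :=
  semi_eulerian T /\
  (poset_rank T = 1%N \/ exists P : T -> {set T}, SE_partition P).

Definition simplicial_complex {V : finType} (D : {set {set V}}) : Prop :=
  set0 \in D /\ (forall F G : {set V}, F \in D -> G \subset F -> G \in D).

Definition facet {V : finType} (D : {set {set V}}) (F : {set V}) : bool :=
  maxset (mem D) F.

(* Makes inclusion the canonical order on [{set V}]. *)
Import Order.DefaultSetSubsetOrder.

Definition face_poset {V : finType} (D : {set {set V}}) : finTPOrderType _ :=
  @adjoin_top _ {set V} D.

(* The Boolean intervals [[R F, F]], for [F] a facet, are disjoint and cover. *)
Definition partitionable {V : finType} (D : {set {set V}}) : Prop :=
  exists R : {set V} -> {set V},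
    (forall F, facet D F -> R F \subset F) /\
    (forall G, G \in D ->
       exists! F : {set V}, facet D F /\ R F \subset G /\ G \subset F).

(* Main.v *)
Require Import Defs.
From mathcomp Require Import all_boot all_order.
From mathcomp Require Import zify.

(** Semi-Eulerian posets are graded, so the complex is pure, and a partition of
    its faces into Boolean intervals [[R, S]], one for each facet [S], is an
    SE-partition as it stands: each class [[R, S)] is used undivided.  The class
    with [R] empty is the initial one, a class with [R = S] is a single facet,
    and everything else is about the faces of one simplex [S] on which a proper
    nonempty face [R] is marked.

    Write [A] for the complement of [R] in [S] and [B] for [R].  The closure of
    [[R, S)] consists of the faces of [S] that do not contain [A]; it is the
    join of the boundary of the simplex [A] with the full simplex [B], a ball
    [ball A B].  Its boundary consists of the faces that moreover do not contain
    [B], the join [sphere A B] of the two boundaries, and the complement of this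
    boundary is exactly [[R, S)].  Attaching one cell along the boundary makes
    the ball Eulerian ([eulerian_susp], [near_eulerian_ball]): in every
    interval, the faces are paired off by adding or removing one vertex, and the
    few that this leaves over are paired with the added cell or with the top.

    It remains to S-partition the semisuspension of [ball A B] with the added
    cell as initial coatom.  Order the vertices of [A].  A face outside the
    initial class contains [B] but not [A]; send it to the facet that omits the
    first vertex of [A] absent from it.  The class of the facet omitting [a] is
    again a Boolean interval, from [B] with the predecessors of [a] up to that
    facet, and it is the facet alone exactly when [a] is last.  So the classes
    are of the form already treated, in a simplex with one vertex less
    ([interval_class]), while the boundary of the initial cell is [sphere A B].
    A sphere [sphere A B] is S-partitioned in the same way, with the first
    absent vertex of [A] and the first absent vertex of [B] together selecting
    the facet; the boundary of its initial facet is the boundary of a simplex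
    [S], which is itself [sphere S [set w]] for a point [w] outside [S].  The two
    constructions call each other and are carried out together, by induction on
    the number of vertices, in [spheres_partitionable].

    The recursion produces posets over ever new carriers (subposets of
    subposets, with tops and cells adjoined).  They are therefore never compared
    with each other, but each is described by a labelling of its elements with
    vertex sets: [face_model] for the face poset of a complex and [simplex_at]
    for the elements below a simplicial one. *)

Set Implicit Arguments.
Unset Strict Implicit.
Unset Printing Implicit Defensive.

Import Order.TTheory.
Local Open Scope order_scope.

(** * Rank and gradedness *)

Section Rank.
Context {disp : Order.disp_t} {T : finTPOrderType disp}.
Implicit Types (x y z : T).

(** A chain below [x] can be prolonged by [x] itself. *)
Lemma rank_lt x y : x < y -> (rank x < rank y)%N.
Proof.
move=> ltxy.
have grow (C : {set T}) : is_chain C && [forall z in C, z < x] ->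
    (#|C| < rank y)%N.
  case/andP=> /forall_inP chC /forall_inP ltC.
  have xC : x \notin C by apply/negP=> /ltC; rewrite ltxx.
  have -> : #|C|.+1 = #|x |: C| by rewrite cardsU1 xC.
  apply: (leq_bigmax_cond (F := fun C : {set T} => #|C|)); apply/andP; split.
    apply/forall_inP=> u; rewrite in_setU1 => uxC.
    apply/forall_inP=> v; rewrite in_setU1 => vxC.
    case/predU1P: uxC vxC => [->|uC] /predU1P[->|vC].
    - by rewrite lexx.
    - by rewrite (ltW (ltC _ vC)) orbT.
    - by rewrite (ltW (ltC _ uC)).
    - exact: (forall_inP (chC u uC)).
  apply/forall_inP=> u; rewrite in_setU1 => /predU1P[->//|/ltC].
  by move/lt_trans; apply.
have : (0 < rank y)%N.
  apply: leq_ltn_trans (grow set0 _); first exact: leq0n.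
  by apply/andP; split; apply/forall_inP=> z; rewrite inE.
case: (rank y) grow => // n grow _; rewrite ltnS.
by apply/bigmax_leqP=> C /grow.
Qed.

(** Along a chain below [x] the ranks are distinct numbers less than [n], so
    such a chain has at most [n] elements. *)
Lemma rank_leq x n : (forall y, y < x -> (rank y < n)%N) -> (rank x <= n)%N.
Proof.
move=> ltn; apply/bigmax_leqP=> C /andP[/forall_inP chC /forall_inP ltC].
case: n ltn => [|n] ltn.
  rewrite leqn0 cards_eq0; apply/eqP/setP=> z; rewrite inE.
  by apply/negP=> /ltC/ltn.
rewrite -[n.+1]card_ord -(@card_in_imset _ _ (fun z => inord (rank z) : 'I_n.+1)).
  exact: max_card.
move=> u v uC vC /(congr1 val) /=.
rewrite !inordK ?ltn ?ltC // => eq_rk.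
have /orP[] := forall_inP (chC _ uC) _ vC; rewrite le_eqVlt.
  by case/predU1P=> // /rank_lt; rewrite eq_rk ltnn.
by case/predU1P=> // /rank_lt; rewrite eq_rk ltnn.
Qed.

Lemma rank_eqS x y n : (forall z, z < x -> (rank z <= n)%N) ->
  y < x -> rank y = n -> rank x = n.+1.
Proof.
move=> le_n ltyx rky; apply/eqP; rewrite eqn_leq -{2}rky rank_lt // andbT.
by apply: rank_leq => z /le_n.
Qed.

(** If some element one rank higher lies between [x] and [y], then a covering
    pair has no room for that element to differ from [y]. *)
Lemma graded_of_step b : (forall x, b <= x) ->
  (forall x y, x < y -> exists z, [/\ x < z, z <= y & rank z = (rank x).+1]) ->
  graded T.
Proof.
move=> b_min step; split; first by exists b.
move=> x y /andP[ltxy /forallP ncov].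
have [z [ltxz lezy <-]] := step x y ltxy.
by move: (ncov z); rewrite ltxz lt_neqAle lezy andbT negbK => /eqP->.
Qed.

End Rank.

(** * Balanced sets of poset elements *)

Section Balanced.
Context {disp : Order.disp_t} {T : finTPOrderType disp}.

(** For an interval this is [balanced], by conversion; stated for arbitrary sets,
    it can be checked piece by piece. *)
Definition balanced_set (X : {set T}) : bool :=
  #|[set z in X | odd (rank z)]| == #|[set z in X | ~~ odd (rank z)]|.

Lemma balanced_setU (X Y : {set T}) : [disjoint X & Y] ->
  balanced_set X -> balanced_set Y -> balanced_set (X :|: Y).
Proof.
move=> disXY /eqP bX /eqP bY; apply/eqP.
have cardU (p : pred T) : #|[set z in X :|: Y | p z]| =
    (#|[set z in X | p z]| + #|[set z in Y | p z]|)%N.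
  rewrite !setIdE setIUl -cardsUI -setIIl.
  by rewrite (disjoint_setI0 disXY) set0I cards0 addn0.
by rewrite !cardU bX bY.
Qed.

Lemma balanced_set2 (x y : T) : rank y = (rank x).+1 -> balanced_set [set x; y].
Proof.
move=> rky; rewrite /balanced_set.
have single (p : pred T) u v : p u -> ~~ p v ->
    #|[set z in [set u; v] | p z]| = 1%N.
  move=> pu npv; rewrite (_ : [set z in _ | _] = [set u]) ?cards1 //.
  apply/setP=> z; rewrite !inE; case: eqP => [->//|_] /=.
  by apply/andP=> -[/eqP-> ]; rewrite (negPf npv).
have [odd_x|even_x] := boolP (odd (rank x)).
  by rewrite (single (fun z => odd (rank z))) ?rky //= ?odd_x // setUC
     (single (fun z => ~~ odd (rank z))) ?rky //= ?odd_x.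
rewrite (single (fun z => ~~ odd (rank z))) ?rky //= ?even_x // setUC.
by rewrite (single (fun z => odd (rank z))) ?rky //= ?even_x.
Qed.

(** Adding or removing [v] pairs the members of [X], and the two members of a pair
    have ranks of opposite parity. *)
Lemma balanced_toggle (W : finType) (g : {set W} -> T) (X : {set {set W}}) (v : W) :
  {in X &, injective g} -> {in X, forall F, rank (g F) = #|F|} ->
  (forall F : {set W}, v \notin F -> (v |: F \in X) = (F \in X)) ->
  balanced_set (g @: X).
Proof.
move=> g_inj rk_g toggleX.
have cardX (p : pred nat) :
    #|[set z in g @: X | p (rank z)]| = #|[set F in X | p #|F|]|.
  rewrite -(card_in_imset (f := g) (D := [set F in X | p #|F|])); last first.
    by move=> F G; rewrite !inE => /andP[FX _] /andP[GX _]; apply: g_inj.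
  apply: eq_card => z; rewrite inE; apply/andP/imsetP.
    by case=> /imsetP[F FX ->]; rewrite rk_g // => pF; exists F; rewrite ?inE ?FX.
  by case=> F; rewrite inE => /andP[FX pF] ->; rewrite imset_f // rk_g.
rewrite /balanced_set (cardX odd) (cardX (fun n => ~~ odd n)).
have splitv (p : pred nat) : #|[set F in X | p #|F|]| =
  (#|[set F in X | (v \notin F) && p #|F|]| +
   #|[set F in X | (v \notin F) && p #|F|.+1]|)%N.
  rewrite -(cardsID [set F : {set W} | v \in F]) addnC; congr (_ + _)%N.
    by apply: eq_card => F; rewrite !inE andbCA.
  (* removing [v] identifies the members containing it with those avoiding it *)
  rewrite -[RHS](card_in_imset (f := fun F : {set W} => v |: F)); last first.
    move=> F G; rewrite !inE => /and3P[_ vF _] /and3P[_ vG _] eqFG.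
    by rewrite -(setU1K vF) eqFG setU1K.
  apply: eq_card => F; rewrite !inE; apply/idP/imsetP.
    case/andP=> /andP[FX pF] vF; exists (F :\ v); last by rewrite setD1K.
    rewrite !inE eqxx /= -toggleX ?setD1K ?FX ?inE ?eqxx //=.
    by have := cardsD1 v F; rewrite vF add1n => <-.
  case=> G; rewrite !inE => /and3P[GX vG pG] ->.
  by rewrite toggleX // GX cardsU1 vG add1n pG setU11.
rewrite (splitv odd) (splitv (fun n => ~~ odd n)) addnC; apply/eqP.
congr (_ + _)%N; apply: eq_card => F; rewrite !inE //=.
by rewrite negbK.
Qed.

End Balanced.

(** * Simplices and face posets *)

Lemma subset_setU1_notin (W : finType) (v : W) (F G : {set W}) :
  v \notin G -> (G \subset v |: F) = (G \subset F).
Proof.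
move=> vG; apply/idP/idP=> [/subsetP GvF|/subset_trans]; last first.
  by apply; apply: subsetU1.
apply/subsetP=> x xG; have := GvF x xG; rewrite in_setU1.
by case/predU1P=> // eq_xv; rewrite -eq_xv xG in vG.
Qed.

Lemma disjoint_imset (W T : finType) (h : {set W} -> T) (K X Y : {set {set W}}) :
  {in K &, injective h} -> X \subset K -> Y \subset K -> [disjoint X & Y] ->
  [disjoint h @: X & h @: Y].
Proof.
move=> h_inj /subsetP XK /subsetP YK disXY; rewrite disjoints_subset.
apply/subsetP=> _ /imsetP[F FX ->]; rewrite inE; apply/imsetP=> -[G GY].
by move/h_inj=> /(_ (XK _ FX) (YK _ GY)) eqFG; rewrite -eqFG (disjointFr disXY) in GY.
Qed.

Section Simplices.
Context {disp : Order.disp_t} {T : finTPOrderType disp} {W : finType}.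
Implicit Types (h : {set W} -> T) (F G S : {set W}).

(** The elements below [h S] form the Boolean lattice of subsets of [S], labelled
    by [h]; the values of [h] elsewhere are arbitrary, so that one labelling can
    serve all simplices of a poset. *)
Definition simplex_at h S : Prop :=
  {in powerset S &, {mono h : F G / F \subset G >-> F <= G}} /\
  (forall x, x <= h S -> x \in h @: powerset S).

Section At.
Variables (h : {set W} -> T) (S : {set W}).
Hypothesis simS : simplex_at h S.

Lemma simplex_le F G : F \subset S -> G \subset S -> (h F <= h G) = (F \subset G).
Proof. by case: simS => mono_h _ FS GS; rewrite mono_h // powersetE. Qed.

Lemma simplex_lt F G : F \subset S -> G \subset S -> (h F < h G) = (F \proper G).
Proof. by move=> FS GS; rewrite lt_leAnge !simplex_le // properE. Qed.

Lemma simplex_inj : {in powerset S &, injective h}.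
Proof.
move=> F G; rewrite !powersetE => FS GS eqh; apply/eqP.
by rewrite eqEsubset -(simplex_le FS GS) -(simplex_le GS FS) eqh lexx.
Qed.

Lemma simplex_below x F : F \subset S -> x <= h F ->
  exists2 G : {set W}, G \subset F & x = h G.
Proof.
case: simS => _ below FS lexF.
have /imsetP[G] : x \in h @: powerset S.
  by apply/below/(le_trans lexF); rewrite simplex_le.
rewrite powersetE => GS def_x; exists G => //.
by rewrite -simplex_le // -def_x.
Qed.

Lemma rank_simplex F : F \subset S -> rank (h F) = #|F|.
Proof.
have [n] := ubnP #|F|; elim: n F => // n IHn F; rewrite ltnS => leFn FS.
have below y : y < h F -> exists2 G : {set W}, G \proper F & y = h G.
  move=> ltyF; have [G GF def_y] := simplex_below FS (ltW ltyF).
  by exists G; rewrite // -(simplex_lt (subset_trans GF FS) FS) -def_y.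
have rk_below G : G \proper F -> rank (h G) = #|G|.
  move=> GF; apply: IHn; first exact: leq_trans (proper_card GF) leFn.
  exact: subset_trans (proper_sub GF) FS.
have [F0|[v vF]] := set_0Vmem F.
  apply/eqP; rewrite F0 cards0 -leqn0 -F0; apply: rank_leq => y /below[G].
  by rewrite F0 properE sub0set andbF.
have vF_proper := properD1 vF.
rewrite (cardsD1 v F) vF add1n; apply: (rank_eqS (y := h (F :\ v))).
- move=> z /below[G GF ->]; rewrite rk_below //.
  by have := proper_card GF; rewrite (cardsD1 v F) vF.
- by rewrite simplex_lt // (subset_trans (proper_sub vF_proper) FS).
exact: rk_below.
Qed.

Lemma simplex_step G : G \proper S ->
  exists z, [/\ h G < z, z <= h S & rank z = (rank (h G)).+1].
Proof.
move=> /properP[GS [v vS vG]].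
have vGS : v |: G \subset S by rewrite subUset sub1set vS.
exists (h (v |: G)); split.
- by rewrite simplex_lt // properUr // sub1set.
- by rewrite simplex_le.
- by rewrite !rank_simplex // cardsU1 vG.
Qed.

(** Toggle a vertex [v] of [S] outside [G]. *)
Lemma balanced_simplex G : G \proper S -> balanced (h G) (h S).
Proof.
move=> /properP[GS [v vS vG]]; rewrite /balanced -/(balanced_set _).
have -> : interval (h G) (h S) = h @: [set F : {set W} | (G \subset F) && (F \subset S)].
  apply/setP=> z; rewrite !inE; apply/andP/imsetP.
    case=> leGz lezS; have [F FS def_z] := simplex_below (subxx S) lezS.
    by exists F => //; rewrite inE FS -(simplex_le GS FS) -def_z leGz.
  by case=> F; rewrite inE => /andP[GF FS] ->; rewrite !simplex_le.
apply: (balanced_toggle (v := v)).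
- move=> F F'; rewrite !inE => /andP[_ FS] /andP[_ FS'].
  by apply: simplex_inj; rewrite powersetE.
- by move=> F; rewrite inE => /andP[_ /rank_simplex].
move=> F vF; rewrite !inE subUset sub1set vS /=; congr (_ && _).
exact: subset_setU1_notin.
Qed.

End At.
End Simplices.

Section FaceModel.
Context {disp : Order.disp_t} {W : finType}.
Implicit Types (F G S : {set W}) (K : {set {set W}}).

(** [T] is the face poset of [K], with a top adjoined, up to the labelling [g];
    the values of [g] outside [K] are arbitrary. *)
Definition face_model (T : finTPOrderType disp) K (g : {set W} -> T) : Prop :=
  [/\ {in K, forall F, g F != \top},
      {in K &, {mono g : F G / F \subset G >-> F <= G}}
    & forall x, x != \top -> x \in g @: K].

(** All the subposets with adjoined top that occur are images of complexes, and
    [insub] turns a labelling of the ambient poset into one of the subposet: its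
    default value [None] is the adjoined top. *)
Lemma face_model_adjoin (T : finPOrderType disp) K (h : {set W} -> T) A :
  {in K &, {mono h : F G / F \subset G >-> F <= G}} -> A = h @: K ->
  face_model K (fun F => insub (h F) : adjoin_top A).
Proof.
move=> mono_h ->; split.
- by move=> F FK; rewrite insubT ?imset_f.
- move=> F G FK GK; rewrite !insubT ?imset_f // => hF hG.
  exact: mono_h.
- case=> // -[x xK] _; have /imsetP[F FK def_x] := xK.
  apply/imsetP; exists F => //; rewrite insubT -?def_x //= => hF.
  by congr Some; apply: val_inj.
Qed.

Section Model.
Context {T : finTPOrderType disp} {K : {set {set W}}} {g : {set W} -> T}.
Hypotheses (modT : face_model K g) (complexK : simplicial_complex K).

Lemma model_cases x : x = \top \/ exists2 F, F \in K & x = g F.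
Proof.
case: modT => _ _ onto; have [->|/onto/imsetP] := eqVneq x \top; first by left.
by right.
Qed.

Lemma model_lt_top F : F \in K -> g F < \top.
Proof. by case: modT => ntop _ _ FK; rewrite lt_neqAle ntop ?lex1. Qed.

Lemma model_le F G : F \in K -> G \in K -> (g F <= g G) = (F \subset G).
Proof. by case: modT => _ mono_g _ FK GK; rewrite mono_g. Qed.

Lemma model_inj : {in K &, injective g}.
Proof.
move=> F G FK GK eqg; apply/eqP.
by rewrite eqEsubset -(model_le FK GK) -(model_le GK FK) eqg lexx.
Qed.

Lemma model_below x F : F \in K -> x <= g F ->
  exists G : {set W}, [/\ G \in K, G \subset F & x = g G].
Proof.
move=> FK; case: (model_cases x) => [->|[G GK ->]].
  by move/le_lt_trans/(_ (model_lt_top FK)); rewrite ltxx.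
by rewrite model_le // => GF; exists G.
Qed.

Lemma interval_model_top G : G \in K ->
  interval (g G) \top = \top |: g @: [set F in K | G \subset F].
Proof.
move=> GK; apply/setP=> x; rewrite in_setU1 [LHS]in_set lex1 andbT.
case: (model_cases x) => [->|[F FK ->]]; first by rewrite lex1 eqxx.
rewrite (lt_eqF (model_lt_top FK)) model_le //; apply/idP/imsetP=> [GF|[F']].
  by exists F; rewrite // in_set FK.
by rewrite in_set => /andP[F'K GF'] /model_inj ->.
Qed.

Lemma simplex_model F : F \in K -> simplex_at g F.
Proof.
case: complexK => _ downK FK; split.
  move=> G H; rewrite !powersetE => GF HF.
  by apply: model_le; apply: downK FK _.
move=> x /(model_below FK)[G [_ GF ->]].
by rewrite imset_f ?powersetE.
Qed.

Lemma rank_model F : F \in K -> rank (g F) = #|F|.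
Proof. by move/simplex_model/rank_simplex; apply. Qed.

Lemma model_bottom x : g set0 <= x.
Proof.
case: complexK => K0 _; case: (model_cases x) => [->|[F FK ->]].
  exact: lex1.
by rewrite model_le ?sub0set.
Qed.

Section Pure.
Variable n : nat.
Hypothesis pureK : forall F, F \in K ->
  exists S : {set W}, [/\ S \in K, F \subset S & #|S| = n].

Lemma rank_model_top : poset_rank T = n.+1.
Proof.
have [K0 _] := complexK; have [S [SK _ cardS]] := pureK K0.
apply: (rank_eqS (y := g S)); rewrite ?rank_model ?model_lt_top //.
move=> x; case: (model_cases x) => [->|[F FK ->] _]; first by rewrite ltxx.
have [S' [_ FS' <-]] := pureK FK; rewrite rank_model //.
exact: subset_leq_card.
Qed.

(** Below a face one vertex can be added at a time; a face that is not contained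
    in a larger one has [n] vertices and is followed by the top. *)
Lemma graded_model : graded T.
Proof.
apply: (graded_of_step model_bottom) => x y.
case: (model_cases x) => [->|[F FK ->]].
  by move/lt_le_trans/(_ (lex1 y)); rewrite ltxx.
have step S : S \in K -> F \proper S ->
    exists z, [/\ g F < z, z <= g S & rank z = (rank (g F)).+1].
  by move/simplex_model/simplex_step; apply.
case: (model_cases y) => [->|[G GK ->]] ltFy.
  have [S [SK FS cardS]] := pureK FK.
  have [eqFS|neqFS] := eqVneq F S.
    exists \top; split=> //.
    by rewrite rank_model // eqFS cardS; apply: rank_model_top.
  have FpS : F \proper S by rewrite properEneq neqFS.
    have [z [ltFz _ rk_z]] := step S SK FpS.
  by exists z; rewrite lex1; split=> //; rewrite ltFz.
by apply: step; rewrite // properE -(model_le FK GK) -(model_le GK FK) -lt_leAnge.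
Qed.

End Pure.
End Model.
End FaceModel.

(** * Joins of two simplex boundaries *)

Section Spheres.
Context {W : finType}.
Implicit Types (A B F G S : {set W}).

(** For disjoint [A] and [B], the join of the boundaries of the simplices [A] and
    [B].  When [B] is a single point its boundary is the complex with the empty
    face only, so that [sphere A B] is then the boundary of the simplex [A]. *)
Definition sphere A B : {set {set W}} :=
  [set F : {set W} | [&& F \subset A :|: B, ~~ (A \subset F) & ~~ (B \subset F)]].

(** For disjoint [A] and [B], the join of the boundary of the simplex [A] with the
    full simplex [B]. *)
Definition ball A B : {set {set W}} :=
  [set F : {set W} | (F \subset A :|: B) && ~~ (A \subset F)].

Variables (A B : {set W}).
Hypotheses (disAB : [disjoint A & B]) (A0 : A != set0) (B0 : B != set0).

Lemma complex_sphere : simplicial_complex (sphere A B).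
Proof.
split=> [|F G]; rewrite !inE; first by rewrite sub0set !subset0 A0 B0.
case/and3P=> FAB AF BF GF; rewrite (subset_trans GF FAB) /=.
by apply/andP; split; [move: AF|move: BF]; apply: contra => /subset_trans; apply.
Qed.

Lemma complex_ball : simplicial_complex (ball A B).
Proof.
split=> [|F G]; rewrite !inE; first by rewrite sub0set !subset0 A0.
case/andP=> FAB AF GF; rewrite (subset_trans GF FAB) /=.
by apply: contra AF => /subset_trans; apply.
Qed.

Lemma in_sphere F : (F \in sphere A B) =
  [&& F \subset A :|: B, ~~ (A \subset F) & ~~ (B \subset F)].
Proof. by rewrite inE. Qed.

Lemma in_ball F : (F \in ball A B) = (F \subset A :|: B) && ~~ (A \subset F).
Proof. by rewrite inE. Qed.

Lemma disjoint_neq a b : a \in A -> b \in B -> a != b.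
Proof.
by move=> aA bB; apply: contraTneq aA => ->; rewrite (disjointFl disAB bB).
Qed.

Lemma mem_sphere_facet a b : a \in A -> b \in B -> (A :|: B) :\ a :\ b \in sphere A B.
Proof.
move=> aA bB; rewrite inE; apply/and3P; split.
- by rewrite (subset_trans (subD1set _ _)) ?subD1set.
- by apply/negP=> /subsetP/(_ a aA); rewrite !inE eqxx andbF.
- by apply/negP=> /subsetP/(_ b bB); rewrite !inE eqxx.
Qed.

Lemma mem_ball_facet a : a \in A -> (A :|: B) :\ a \in ball A B.
Proof.
move=> aA; rewrite inE subD1set /=.
by apply/negP=> /subsetP/(_ a aA); rewrite !inE eqxx.
Qed.

Lemma card_ball_facet a : a \in A -> #|(A :|: B) :\ a|.+1 = (#|A| + #|B|)%N.
Proof.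
move=> aA; rewrite -cardsUI (disjoint_setI0 disAB) cards0 addn0.
by rewrite [RHS](cardsD1 a) inE aA.
Qed.

Lemma card_sphere_facet a b : a \in A -> b \in B ->
  #|(A :|: B) :\ a :\ b|.+2 = (#|A| + #|B|)%N.
Proof.
move=> aA bB; rewrite -(card_ball_facet aA) [X in _ = X.+1](cardsD1 b).
by rewrite !inE bB orbT eq_sym disjoint_neq.
Qed.

Lemma sub_sphere_facet F : F \in sphere A B ->
  exists a b, [/\ a \in A, b \in B & F \subset (A :|: B) :\ a :\ b].
Proof.
rewrite inE => /and3P[FAB /subsetPn[a aA aF] /subsetPn[b bB bF]].
by exists a, b; rewrite !subsetD1 FAB aF bF.
Qed.

Lemma sub_ball_facet F : F \in ball A B ->
  exists2 a, a \in A & F \subset (A :|: B) :\ a.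
Proof.
rewrite inE => /andP[FAB /subsetPn[a aA aF]].
by exists a; rewrite // !subsetD1 FAB aF.
Qed.

Lemma pure_sphere F : F \in sphere A B -> exists S : {set W},
  [/\ S \in sphere A B, F \subset S & #|S| = (#|A| + #|B|).-2].
Proof.
case/sub_sphere_facet=> a [b [aA bB FS]]; exists ((A :|: B) :\ a :\ b).
by rewrite mem_sphere_facet // -(card_sphere_facet aA bB).
Qed.

Lemma pure_ball F : F \in ball A B -> exists S : {set W},
  [/\ S \in ball A B, F \subset S & #|S| = (#|A| + #|B|).-1].
Proof.
case/sub_ball_facet=> a aA FS; exists ((A :|: B) :\ a).
by rewrite mem_ball_facet // -(card_ball_facet aA).
Qed.

Lemma sphere_sub_ball : sphere A B \subset ball A B.
Proof. by apply/subsetP=> F; rewrite !inE => /and3P[-> ->]. Qed.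

(** Choose [a] in [A] and [b] in [B] outside [G].  Toggling [a] pairs the faces that
    stay in the sphere when [a] is added; toggling [b] pairs those of the others
    that stay in it when [b] is added.  The only face left over contains all
    vertices but [a] and [b]; it is a facet and is paired with [t].  Here [t] may
    be the top of the face poset of the sphere or a cell glued along it. *)
Lemma balanced_sphere {disp} {T : finTPOrderType disp} (h : {set W} -> T)
    (t : T) G :
  G \in sphere A B -> {in sphere A B &, injective h} ->
  {in sphere A B, forall F, rank (h F) = #|F|} ->
  rank t = (#|A| + #|B|).-1 -> {in sphere A B, forall F, h F != t} ->
  interval (h G) t = t |: h @: [set F in sphere A B | G \subset F] ->
  balanced (h G) t.
Proof.
move=> GK h_inj rk_h rk_t h_neq eq_int; rewrite /balanced eq_int -/(balanced_set _).
have [a [b [aA bB]]] := sub_sphere_facet GK.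
rewrite !subsetD1 -andbA => /and3P[GAB aG bG].
set S := (A :|: B) :\ a :\ b.
have aB : a \notin B by rewrite (disjointFr disAB).
have bA : b \notin A by rewrite (disjointFl disAB).
have neq_ab := disjoint_neq aA bB.
pose X1 := [set F in sphere A B | (G \subset F) && ~~ (A \subset a |: F)].
pose X2 := [set F in sphere A B |
  [&& G \subset F, A \subset a |: F & ~~ (B \subset b |: F)]].
have inX1 F : (F \in X1) = (F \in sphere A B) && ((G \subset F) && ~~ (A \subset a |: F)).
  by rewrite in_set.
have inX2 F : (F \in X2) = (F \in sphere A B) &&
    [&& G \subset F, A \subset a |: F & ~~ (B \subset b |: F)].
  by rewrite in_set.
have SK : S \in sphere A B := mem_sphere_facet aA bB.
have sub1 : X1 \subset sphere A B by apply/subsetP=> F; rewrite inX1 => /andP[].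
have sub2 : X2 \subset sphere A B by apply/subsetP=> F; rewrite inX2 => /andP[].
have -> : [set F in sphere A B | G \subset F] = X1 :|: X2 :|: [set S].
  apply/setP=> F; rewrite !in_setU in_set1 inX1 inX2 in_set.
  apply/andP/idP=> [[FK GF]|].
    rewrite FK GF /=; case: (boolP (A \subset a |: F)) => //= AaF.
    case: (boolP (B \subset b |: F)) => //= BbF.
    move: FK; rewrite inE => /and3P[FAB AF BF].
    rewrite eqEsubset {1}/S !subsetD1 FAB -andbA; apply/and3P; split.
    - by apply: contra AF => aF; rewrite (subset_trans AaF) // subUset sub1set aF /=.
    - by apply: contra BF => bF; rewrite (subset_trans BbF) // subUset sub1set bF /=.
    apply/subsetP=> x; rewrite !inE => /and3P[/negPf neq_xb /negPf neq_xa].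
    case/orP=> [/(subsetP AaF)|/(subsetP BbF)]; by rewrite !inE ?neq_xa ?neq_xb.
  case/orP=> [/orP[]|/eqP->].
  - by case/and3P.
  - by case/and4P.
  - by rewrite SK !subsetD1 GAB aG.
rewrite !imsetU imset_set1 setUC -setUA.
apply: balanced_setU.
- rewrite disjoints_subset -imsetU; apply/subsetP=> _ /imsetP[F FX ->].
  have FK : F \in sphere A B.
    by move: FX; rewrite in_setU => /orP[/(subsetP sub1)|/(subsetP sub2)].
  rewrite !inE negb_or h_neq // andbT; apply/eqP=> /h_inj eqFS.
  move: FX; rewrite {}eqFS // in_setU inX1 inX2; case/orP=> /and3P[_ _].
    case/negP; apply/subsetP=> x xA; rewrite !inE xA.
    by case: eqP => //= _; rewrite andbT; apply: contraNneq bA => <-.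
  case/andP=> _ /negP[]; apply/subsetP=> x xB; rewrite !inE xB orbT andbT.
  by case: eqP => //= _; apply: contraNneq aB => <-.
- apply: balanced_setU.
  + apply: (disjoint_imset h_inj) => //; rewrite disjoints_subset.
    apply/subsetP=> F; rewrite in_setC inX1 inX2 => /and3P[_ _ /negPf->].
    by rewrite !andbF.
  + apply: (balanced_toggle (v := a)).
    * by apply: sub_in2 h_inj; apply: (subsetP sub1).
    * by move=> F /(subsetP sub1) /rk_h.
    move=> F aF; rewrite !inX1 !in_sphere subUset sub1set inE aA /= setUA setUid.
    rewrite (subset_setU1_notin _ aB) (subset_setU1_notin _ aG).
    case: (boolP (A \subset a |: F)) => [|AaF]; rewrite ?andbF //=.
    suff -> : A \subset F = false by [].
    by apply: contraNF AaF => /subset_trans; apply; apply: subsetU1.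
  + apply: (balanced_toggle (v := b)).
    * by apply: sub_in2 h_inj; apply: (subsetP sub2).
    * by move=> F /(subsetP sub2) /rk_h.
    move=> F bF; rewrite !inX2 !in_sphere subUset sub1set inE bB orbT /=.
    rewrite (setUCA [set a]) (setUA [set b] [set b]) setUid.
    rewrite !(subset_setU1_notin _ bA) (subset_setU1_notin _ bG).
    case: (boolP (B \subset b |: F)) => [|BbF]; rewrite ?andbF //=.
    suff -> : B \subset F = false by [].
    by apply: contraNF BbF => /subset_trans; apply; apply: subsetU1.
- by apply: balanced_set2; rewrite rk_h // rk_t -(card_sphere_facet aA bB).
Qed.

(** Intervals below a face are Boolean; the others end at the top. *)
Theorem eulerian_sphere {disp} {T : finTPOrderType disp} (g : {set W} -> T) :
  face_model (sphere A B) g -> eulerian T.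
Proof.
move=> modT; split; first exact: graded_model modT complex_sphere _ pure_sphere.
have n_gt1 : (1 < #|A| + #|B|)%N by move: A0 B0; rewrite -!card_gt0; lia.
have rk_g F : F \in sphere A B -> rank (g F) = #|F|.
  exact: rank_model modT complex_sphere _.
move=> x y; case: (model_cases modT x) => [->|[G GK ->]].
  by move/lt_le_trans/(_ (lex1 y)); rewrite ltxx.
case: (model_cases modT y) => [->|[H HK ->]] ltxy.
  apply: (balanced_sphere GK) => //; last exact: (interval_model_top modT GK).
  - exact: model_inj modT.
  - by rewrite [LHS](rank_model_top modT complex_sphere pure_sphere); lia.
  - by case: modT.
have simH := simplex_model modT complex_sphere HK.
apply: (balanced_simplex simH).
by rewrite properE -(model_le modT GK HK) -(model_le modT HK GK) -lt_leAnge.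
Qed.

End Spheres.

(** * Balls and their boundaries *)

Section Balls.
Context {disp : Order.disp_t} {W : finType}.
Implicit Types (F G S : {set W}).
Variables (A B : {set W}).
Hypotheses (disAB : [disjoint A & B]) (A0 : A != set0) (B0 : B != set0).

(** Choose [a] in [A] outside [G].  Toggling [a] pairs the faces that stay in the
    ball when [a] is added; as [B] is contained in [G], the only face left over is
    the facet omitting [a], which is paired with [t]. *)
Lemma balanced_ball {T : finTPOrderType disp} (h : {set W} -> T) (t : T) G :
  G \in ball A B -> B \subset G -> {in ball A B &, injective h} ->
  {in ball A B, forall F, rank (h F) = #|F|} ->
  rank t = (#|A| + #|B|)%N -> {in ball A B, forall F, h F != t} ->
  interval (h G) t = t |: h @: [set F in ball A B | G \subset F] ->
  balanced (h G) t.
Proof.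
move=> GK BG h_inj rk_h rk_t h_neq eq_int; rewrite /balanced eq_int -/(balanced_set _).
have [a aA] := sub_ball_facet GK.
rewrite subsetD1 => /andP[GAB aG]; set S := (A :|: B) :\ a.
pose X := [set F in ball A B | (G \subset F) && ~~ (A \subset a |: F)].
have inX F : (F \in X) = (F \in ball A B) && ((G \subset F) && ~~ (A \subset a |: F)).
  by rewrite in_set.
have SK : S \in ball A B := mem_ball_facet _ aA.
have subX : X \subset ball A B by apply/subsetP=> F; rewrite inX => /andP[].
have -> : [set F in ball A B | G \subset F] = X :|: [set S].
  apply/setP=> F; rewrite in_setU in_set1 inX in_set.
  apply/andP/idP=> [[FK GF]|].
    rewrite FK GF /=; case: (boolP (A \subset a |: F)) => //= AaF.
    move: FK; rewrite in_ball => /andP[FAB AF].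
    rewrite eqEsubset {1}/S !subsetD1 FAB /=; apply/andP; split.
      by apply: contra AF => aF; rewrite (subset_trans AaF) // subUset sub1set aF /=.
    apply/subsetP=> x; rewrite !inE => /andP[/negPf neq_xa].
    case/orP=> [/(subsetP AaF)|xB]; first by rewrite !inE neq_xa.
    by rewrite (subsetP GF) // (subsetP BG).
  case/orP=> [|/eqP->]; first by case/and3P.
  by rewrite SK !subsetD1 GAB aG.
rewrite !imsetU imset_set1 setUC -setUA.
apply: balanced_setU.
- rewrite disjoints_subset; apply/subsetP=> _ /imsetP[F FX ->].
  have FK := subsetP subX F FX.
  rewrite !inE negb_or h_neq // andbT; apply/eqP=> /h_inj eqFS.
  move: FX; rewrite {}eqFS // inX; case/and3P=> _ _ /negP[].
  by apply/subsetP=> x xA; rewrite !inE xA andbT orbN.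
- apply: (balanced_toggle (v := a)).
  + by apply: sub_in2 h_inj; apply: (subsetP subX).
  + by move=> F /(subsetP subX) /rk_h.
  move=> F aF; rewrite !inX !in_ball subUset sub1set inE aA /= setUA setUid.
  rewrite (subset_setU1_notin _ aG).
  case: (boolP (A \subset a |: F)) => [|AaF]; rewrite ?andbF //=.
  suff -> : A \subset F = false by [].
  by apply: contraNF AaF => /subset_trans; apply; apply: subsetU1.
- by apply: balanced_set2; rewrite rk_h // rk_t -(card_ball_facet disAB aA).
Qed.

Section BallModel.
Variables (T : finTPOrderType disp) (g : {set W} -> T).
Hypothesis modT : face_model (ball A B) g.

Let complexT : simplicial_complex (ball A B) := complex_ball B A0.

Let ball_gt0 : (0 < #|A| + #|B|)%N.
Proof. by rewrite addn_gt0 card_gt0 A0. Qed.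

Lemma graded_ball : graded T.
Proof. exact: graded_model modT complexT _ (pure_ball disAB). Qed.

Lemma rank_ball_top : rank (\top : T) = (#|A| + #|B|)%N.
Proof.
by rewrite [LHS](rank_model_top modT complexT (pure_ball disAB)) prednK.
Qed.

Lemma rank_ball F : F \in ball A B -> rank (g F) = #|F|.
Proof. exact: rank_model modT complexT _. Qed.

Lemma balanced_card (x y : T) : balanced x y -> ~~ odd #|interval x y|.
Proof.
move=> /eqP bal; rewrite -(cardsID [set z | odd (rank z)]).
have -> : interval x y :\: [set z | odd (rank z)] =
    [set z in interval x y | ~~ odd (rank z)].
  by apply/setP=> z; rewrite !inE andbC.
by rewrite -setIdE -bal addnn odd_double.
Qed.

(** Let [g F] lie below [p] with [[p, \top]] of size three.  If [F] contained [B], so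
    would the label of [p], and [[p, \top]] would be balanced and hence of even
    size.  Conversely, a face avoiding some [a] in [A] and some [b] in [B] lies in
    the one that avoids nothing else, and above the latter there is only one other
    proper face, obtained by adding [b]: adding [a] would complete [A]. *)
Lemma boundary_ball F : F \in ball A B ->
  (g F \in (boundary : {set T})) = ~~ (B \subset F).
Proof.
move=> FK; have [_ AF] := andP (etrans (esym (in_ball A B F)) FK).
apply/idP/idP.
  rewrite inE => /exists_inP[p pS leFp].
  apply: contraTN (pS) => BF; case: (model_cases modT p) => [def_p|[P PK def_p]].
    apply/negP=> _; have := top_notin_closure T.
    by rewrite -def_p inE => /exists_inP[]; exists p.
  move: leFp; rewrite inE def_p (model_le modT) // => FP.
  suff /balanced_card : balanced (g P) \top by apply: contraNneq => ->.
  apply: (balanced_ball PK (subset_trans BF FP)).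
  - exact: model_inj modT.
  - exact: rank_ball.
  - exact: rank_ball_top.
  - by case: modT.
  - exact: (interval_model_top modT PK).
move=> BF; have FS : F \in sphere A B.
  by move: FK; rewrite in_sphere in_ball => /andP[-> ->].
have [a [b [aA bB FSab]]] := sub_sphere_facet FS.
set S := (A :|: B) :\ a :\ b in FSab; set S' := (A :|: B) :\ a.
have SK : S \in ball A B.
  by apply: (subsetP (sphere_sub_ball A B)); apply: mem_sphere_facet.
have S'K : S' \in ball A B := mem_ball_facet B aA.
have neqSS' : S != S'.
  apply/eqP=> /setP/(_ b); rewrite !inE eqxx bB orbT andbT eq_sym.
  by rewrite (disjoint_neq disAB).
rewrite inE; apply/exists_inP; exists (g S); last by rewrite (model_le modT).
rewrite inE (interval_model_top modT) //.
have -> : [set F0 in ball A B | S \subset F0] = [set S; S'].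
  apply/setP=> F'; rewrite in_set in_set2; apply/andP/idP; last first.
    by case/orP=> /eqP->; rewrite ?SK ?S'K ?subD1set ?subxx.
  case; rewrite in_ball => /andP[F'AB AF'] SF'.
  have aF' : a \notin F'.
    apply: contra AF' => aF'; apply/subsetP=> x xA.
    have [->//|neq_xa] := eqVneq x a; apply: (subsetP SF').
    by rewrite !inE neq_xa xA (disjoint_neq disAB).
  have F'S' : F' \subset S' by rewrite subsetD1 F'AB.
  have [bF'|bF'] := boolP (b \in F'); last first.
    by rewrite (_ : F' = S) ?eqxx //; apply/eqP; rewrite eqEsubset SF' subsetD1 F'S' bF'.
  rewrite (_ : F' = S') ?eqxx ?orbT //; apply/eqP; rewrite eqEsubset F'S'.
  have -> : S' = b |: S.
    by rewrite setD1K // !inE bB orbT andbT eq_sym (disjoint_neq disAB).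
  by rewrite subUset sub1set bF'.
rewrite cardsU1 card_in_imset ?cards2 ?neqSS'; last first.
  by move=> F1 F2; rewrite !in_set2 => /orP[]/eqP-> /orP[]/eqP->; apply: (model_inj modT).
suff -> : \top \notin g @: [set S; S'] by [].
apply/imsetP=> -[F']; rewrite in_set2 => F'SS' /eqP; rewrite eq_sym; apply/negP.
by case: modT => ntop _ _; apply: ntop; case/orP: F'SS' => /eqP->.
Qed.

Lemma boundary_ball_sphere F : F \in ball A B ->
  (g F \in (boundary : {set T})) = (F \in sphere A B).
Proof.
move=> FK; rewrite boundary_ball // in_sphere andbA.
by move: FK; rewrite in_ball => ->.
Qed.

End BallModel.
End Balls.

(** * The semisuspension of a ball is Eulerian *)

Section Suspension.
Context {disp : Order.disp_t} {W : finType}.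
Implicit Types (F G S : {set W}).
Variables (A B : {set W}).
Hypotheses (disAB : [disjoint A & B]) (A0 : A != set0) (B0 : B != set0).
Variables (T : finTPOrderType disp) (g : {set W} -> T).
Hypothesis modT : face_model (ball A B) g.

Let complexT : simplicial_complex (ball A B) := complex_ball B A0.

Let n_gt1 : (1 < #|A| + #|B|)%N.
Proof. by move: A0 B0; rewrite -!card_gt0; lia. Qed.

Definition susp_face F : semisuspension T := Some (g F).

Lemma susp_cases (u : semisuspension T) :
  [\/ u = \top, u = added_coatom | exists2 F, F \in ball A B & u = susp_face F].
Proof.
case: u => [x|]; last by apply: Or32.
case: (model_cases modT x) => [->|[F FK ->]]; first by apply: Or31.
by apply: Or33; exists F.
Qed.

Lemma susp_face_le F G : F \in ball A B -> G \in ball A B ->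
  (susp_face F <= susp_face G) = (F \subset G).
Proof. by move=> FK GK; rewrite -(model_le modT FK GK). Qed.

Lemma susp_face_inj : {in ball A B &, injective susp_face}.
Proof. by move=> F G FK GK [] /(model_inj modT); apply. Qed.

Lemma susp_face_lt_top F : F \in ball A B -> susp_face F < \top.
Proof. by move=> /(model_lt_top modT); rewrite !lt_leAnge. Qed.

(** The order below the added coatom is membership in the boundary by
    definition. *)
Lemma susp_face_le_added F : F \in ball A B ->
  (susp_face F <= added_coatom) = (F \in sphere A B).
Proof. exact: boundary_ball_sphere. Qed.

Lemma added_lt_top : (added_coatom : semisuspension T) < \top.
Proof. by rewrite lt_neqAle lex1. Qed.

Lemma added_nle_face F : F \in ball A B -> (added_coatom <= susp_face F) = false.
Proof.
by case: modT => ntop _ _ FK; apply/negbTE; apply: ntop.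
Qed.

Lemma sphere_ball F : F \in sphere A B -> F \in ball A B.
Proof. exact: (subsetP (sphere_sub_ball A B)). Qed.

Lemma simplex_susp F : F \in ball A B -> simplex_at susp_face F.
Proof.
move=> FK; split=> [G H|u leuF].
  rewrite !powersetE => GF HF.
  by apply: susp_face_le; apply: complexT.2 FK _.
move: leuF; case: (susp_cases u) => [->|->|[G GK ->]].
- by move/le_lt_trans/(_ (susp_face_lt_top FK)); rewrite ltxx.
- by rewrite added_nle_face.
by rewrite susp_face_le // => GF; rewrite imset_f ?powersetE.
Qed.

Lemma rank_susp_face F : F \in ball A B -> rank (susp_face F) = #|F|.
Proof. by move/simplex_susp/rank_simplex; apply. Qed.

(** The added coatom is glued along the whole sphere, so its rank is that of the top
    of the face poset of the sphere. *)
Lemma rank_added : rank (added_coatom : semisuspension T) = (#|A| + #|B|).-1.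
Proof.
have [K0 _] := complex_sphere A0 B0.
have [S [SK _ cardS]] := pure_sphere disAB K0.
rewrite (rank_eqS (n := (#|A| + #|B|).-2) (y := susp_face S)); first lia.
- move=> u; case: (susp_cases u) => [->|->|[F FK ->]].
  + by move/lt_trans/(_ added_lt_top); rewrite ltxx.
  + by rewrite ltxx.
  move/ltW; rewrite susp_face_le_added // => /(pure_sphere disAB)[S' [_ FS' <-]].
  by rewrite rank_susp_face // subset_leq_card.
- by rewrite lt_neqAle susp_face_le_added ?SK ?sphere_ball.
- by rewrite rank_susp_face ?sphere_ball.
Qed.

Lemma rank_susp_top : rank (\top : semisuspension T) = (#|A| + #|B|)%N.
Proof.
rewrite (rank_eqS (n := (#|A| + #|B|).-1) (y := added_coatom)); first lia.
- move=> u; case: (susp_cases u) => [->|->|[F FK ->]]; rewrite ?rank_added ?ltxx //.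
  move=> _; have [S' [_ FS' <-]] := pure_ball disAB FK.
  by rewrite rank_susp_face // subset_leq_card.
- exact: added_lt_top.
- exact: rank_added.
Qed.

Lemma graded_susp : graded (semisuspension T).
Proof.
apply: (graded_of_step (b := susp_face set0)) => [u|u v].
  have [K0 _] := complexT; have [K0' _] := complex_sphere A0 B0.
  case: (susp_cases u) => [->|->|[F FK ->]]; first exact: lex1.
    by rewrite susp_face_le_added.
  by rewrite susp_face_le ?sub0set.
case: (susp_cases u) => [->|->|[F FK ->]].
- by move/lt_le_trans/(_ (lex1 v)); rewrite ltxx.
- case: (susp_cases v) => [->|->|[G GK ->]]; rewrite ?ltxx //.
    by exists \top; rewrite rank_susp_top rank_added; split=> //; lia.
  by rewrite lt_leAnge added_nle_face.
have step S : S \in ball A B -> F \proper S -> exists z : semisuspension T,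
    [/\ susp_face F < z, z <= susp_face S & rank z = (rank (susp_face F)).+1].
  by move/simplex_susp/simplex_step; apply.
case: (susp_cases v) => [->|->|[G GK ->]] ltFv.
- have [S [SK FS cardS]] := pure_ball disAB FK.
  have [eqFS|neqFS] := eqVneq F S.
    exists \top; split=> //; rewrite rank_susp_face // eqFS cardS rank_susp_top.
    lia.
  have FpS : F \proper S by rewrite properEneq neqFS.
  have [z [ltFz _ rk_z]] := step S SK FpS.
  by exists z; rewrite lex1.
- have := ltW ltFv; rewrite susp_face_le_added // => /(pure_sphere disAB).
  case=> S [SK FS cardS]; have [eqFS|neqFS] := eqVneq F S.
    exists added_coatom; split=> //; rewrite rank_susp_face // eqFS cardS rank_added.
    lia.
  have FpS : F \proper S by rewrite properEneq neqFS.
  have [z [ltFz lezS rk_z]] := step S (sphere_ball SK) FpS.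
  exists z; split=> //; apply: le_trans lezS _.
  by rewrite susp_face_le_added ?sphere_ball.
apply: step; rewrite // properE -(susp_face_le FK GK) -(susp_face_le GK FK).
by rewrite -lt_leAnge.
Qed.

(** If [F] contains [B], the added coatom is not above [F] and the interval is the
    one in the ball.  Otherwise some [b] in [B] is missing from [F], and toggling
    it never leaves the ball; the two elements that are not faces form the last
    pair. *)
Lemma balanced_susp_top F : F \in ball A B -> balanced (susp_face F) \top.
Proof.
move=> FK; have [BF|BF] := boolP (B \subset F).
  apply: (balanced_ball disAB FK BF) => //.
  - exact: susp_face_inj.
  - exact: rank_susp_face.
  - exact: rank_susp_top.
  - by move=> G /susp_face_lt_top; apply: contraTneq => ->; rewrite ltxx.
  apply/setP=> u; rewrite in_setU1 [LHS]in_set lex1 andbT.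
  case: (susp_cases u) => [->|->|[G GK ->]]; first by rewrite lex1 eqxx.
    rewrite susp_face_le_added // in_sphere BF !andbF; apply/esym/imsetP.
    by case.
  rewrite susp_face_le // lt_eqF ?susp_face_lt_top //=.
  apply/idP/imsetP=> [FG|[G']]; first by exists G; rewrite // in_set GK.
  by rewrite in_set => /andP[G'K FG'] /susp_face_inj ->.
have [b bB bF] := subsetPn BF; have bA : b \notin A by rewrite (disjointFl disAB).
set X := [set G in ball A B | F \subset G].
rewrite /balanced -/(balanced_set _).
have -> : interval (susp_face F) \top = susp_face @: X :|: [set added_coatom; \top].
  apply/setP=> u; rewrite in_setU in_set2 [LHS]in_set lex1 andbT.
  case: (susp_cases u) => [->|->|[G GK ->]]; first by rewrite lex1 eqxx !orbT.
    rewrite susp_face_le_added // eqxx orbT in_sphere andbA -in_ball FK.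
    by rewrite BF.
  rewrite susp_face_le // (lt_eqF (susp_face_lt_top GK)) /= orbF.
  apply/idP/imsetP=> [FG|[G']]; first by exists G; rewrite // in_set GK.
  by rewrite in_set => /andP[G'K FG'] /susp_face_inj ->.
have subX : X \subset ball A B by apply/subsetP=> G; rewrite in_set => /andP[].
apply: balanced_setU.
- rewrite disjoints_subset; apply/subsetP=> _ /imsetP[G /(subsetP subX) GK ->].
  by rewrite in_setC in_set2 (lt_eqF (susp_face_lt_top GK)) orbF.
- apply: (balanced_toggle (v := b)).
  + by apply: sub_in2 susp_face_inj; apply: (subsetP subX).
  + by move=> G /(subsetP subX) /rank_susp_face.
  move=> G bG; rewrite !in_set subUset sub1set inE bB orbT /=.
  by rewrite (subset_setU1_notin _ bA) (subset_setU1_notin _ bF).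
- apply: balanced_set2; rewrite rank_added rank_susp_top; lia.
Qed.

Theorem eulerian_susp : eulerian (semisuspension T).
Proof.
split; first exact: graded_susp.
move=> u v; case: (susp_cases u) => [->|->|[F FK ->]].
- by move/lt_le_trans/(_ (lex1 v)); rewrite ltxx.
- case: (susp_cases v) => [->|->|[G GK ->]]; rewrite ?ltxx //; last first.
    by rewrite lt_leAnge added_nle_face.
  move=> _; rewrite /balanced -/(balanced_set _).
  have -> : interval added_coatom \top = [set (added_coatom : semisuspension T); \top].
    apply/setP=> u'; rewrite in_set2 in_set lex1 andbT.
    case: (susp_cases u') => [->|->|[G GK ->]]; rewrite ?lex1 ?lexx ?eqxx ?orbT //.
  apply: balanced_set2; rewrite rank_added rank_susp_top; lia.
case: (susp_cases v) => [->|->|[G GK ->]] ltFv; first exact: balanced_susp_top.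
- have FS : F \in sphere A B by rewrite -susp_face_le_added // ltW.
  apply: (balanced_sphere disAB FS) => //.
  + by apply: sub_in2 susp_face_inj; apply: sphere_ball.
  + by move=> G /sphere_ball/rank_susp_face.
  + exact: rank_added.
  apply/setP=> u'; rewrite in_setU1 [LHS]in_set.
  case: (susp_cases u') => [->|->|[G GK ->]].
  + rewrite (lt_geF added_lt_top) andbF (gt_eqF added_lt_top).
    apply/esym/imsetP=> -[G]; rewrite in_set => /andP[/sphere_ball GK _] /eqP.
    by rewrite (gt_eqF (susp_face_lt_top GK)).
  + by rewrite lexx ltW.
  rewrite susp_face_le // susp_face_le_added //=; apply/andP/imsetP.
    by case=> FG GS; exists G; rewrite // in_set GS.
  case=> G'; rewrite in_set => /andP[G'S FG'] /susp_face_inj -> //.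
  exact: sphere_ball.
apply: (balanced_simplex (simplex_susp GK)).
by rewrite properE -(susp_face_le FK GK) -(susp_face_le GK FK) -lt_leAnge.
Qed.

Theorem near_eulerian_ball : near_eulerian T.
Proof.
split; first exact: graded_ball modT.
exists (semisuspension T), added_coatom, Some; split=> //.
- exact: eulerian_susp.
- by rewrite /coatom rank_added rank_susp_top prednK //; lia.
move=> u; apply/codomP/idP=> [[x ->]//|].
by case: u => // x _; exists x.
Qed.

End Suspension.

(** * Boolean intervals as classes *)

Section Classes.
Context {disp : Order.disp_t} {W : finType}.
Implicit Types (A B F G R S : {set W}).

Definition face_interval R S : {set {set W}} :=
  [set F : {set W} | (R \subset F) && (F \subset S)].

(** The two statements of the joint induction, on the number [n] of vertices. *)
Definition sphere_partitionable (n : nat) : Prop :=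
  forall A B (T : finTPOrderType disp) (g : {set W} -> T),
    [disjoint A & B] -> A != set0 -> B != set0 -> (#|A| + #|B|)%N = n ->
    face_model (sphere A B) g -> S_partitionable T.

Definition susp_partitionable (n : nat) : Prop :=
  forall A B (T : finTPOrderType disp) (g : {set W} -> T),
    [disjoint A & B] -> A != set0 -> B != set0 -> (#|A| + #|B|)%N = n ->
    face_model (ball A B) g ->
    exists Q : semisuspension T -> {set semisuspension T},
      S_partition Q added_coatom.

(** The closure of [[R, S)] is the ball on [S :\: R] and [R], and the labels of its
    boundary are the faces that do not contain [R], which are those missing from
    [[R, S)]. *)
Lemma interval_class (T : finTPOrderType disp) (h : {set W} -> T) R S (C : {set T}) :
  simplex_at h S -> R \subset S -> R != set0 -> R != S ->
  susp_partitionable #|S| -> C = h @: face_interval R S :\ h S ->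
  let G : finTPOrderType disp := adjoin_top (lower_closure C) in
  [/\ near_eulerian_class #|S| C, poset_rank (semisuspension G) = #|S|
    & exists Q : semisuspension G -> {set semisuspension G},
        S_partition Q added_coatom].
Proof.
move=> simS RS R0 neqRS partW def_C.
pose A := S :\: R.
have disAR : [disjoint A & R] by rewrite disjoints_subset; apply/subsetP=> x; rewrite !inE => /andP[].
have eqAR : A :|: R = S by rewrite setUC -{1}(setIidPr RS) setID.
have A0 : A != set0.
  by rewrite setD_eq0; apply: contra neqRS => SR; rewrite eqEsubset RS.
have cardAR : (#|A| + #|R|)%N = #|S| by rewrite addnC -(cardsID R S) (setIidPr RS).
have sub_ball F : F \in ball A R -> F \subset S by rewrite in_ball eqAR => /andP[].
have memC F : F \subset S -> (h F \in C) = (R \subset F) && (F != S).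
  move=> FS; rewrite def_C in_setD1 andbC; congr (_ && _).
    apply/imsetP/idP=> [[F']|RF]; last by exists F; rewrite // in_set RF.
    rewrite in_set => /andP[RF' F'S] /(simplex_inj simS).
    by rewrite !powersetE => ->.
  congr (~~ _); apply/eqP/eqP => [/(simplex_inj simS)|->//].
  by rewrite !powersetE; apply.
have in_C x : x \in C -> exists2 F : {set W}, F \subset S & x = h F.
  rewrite def_C in_setD1 => /andP[_ /imsetP[F]]; rewrite in_set.
  by case/andP=> _ FS ->; exists F.
have closC : lower_closure C = h @: ball A R.
  apply/setP=> x; rewrite inE; apply/exists_inP/imsetP.
    case=> p pC; have [F' F'S def_p] := in_C p pC.
    move: pC; rewrite def_p memC // => /andP[RF' neqF'S].
    case/(simplex_below simS F'S)=> F FF' ->; exists F => //.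
    rewrite in_ball eqAR (subset_trans FF') //=.
    apply: contra neqF'S => AF; rewrite eqEsubset F'S -eqAR subUset RF' andbT.
    exact: subset_trans AF FF'.
  case=> F FK ->; have FS := sub_ball F FK.
  have FRS : F :|: R \subset S by rewrite subUset FS.
  (* a face of the ball becomes a member of the class when [R] is added to it *)
  exists (h (F :|: R)); last by rewrite (simplex_le simS) ?subsetUl.
  rewrite memC // subsetUr /=; move: FK; rewrite in_ball => /andP[_].
  apply: contra => /eqP eqS; apply/subsetP=> y; rewrite in_setD -eqS in_setU.
  by case/andP=> /negPf->; rewrite orbF.
pose G : finTPOrderType disp := adjoin_top (lower_closure C).
pose g F : G := insub (h F).
have modG : face_model (ball A R) g.
  apply: face_model_adjoin closC => F F' /sub_ball FS /sub_ball F'S.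
  exact: (simplex_le simS).
have gE F : F \in ball A R -> exists2 y : {x : T | x \in lower_closure C},
      val y = h F & g F = (Some y : adjoin_top (lower_closure C)).
  move=> FK; have hF : h F \in lower_closure C by rewrite closC imset_f.
  by exists (Sub (h F) hF); rewrite ?SubK // /g insubT.
have facesE : faces (boundary : {set G}) = h @: sphere A R.
  apply/setP=> x; rewrite inE; apply/exists_inP/imsetP.
    case=> y yb /eqP <-; 
    have /imsetP[F FK def_y] : val y \in h @: ball A R by rewrite -closC (valP y).
    exists F => //.
    rewrite -(boundary_ball_sphere disAR A0 modG FK).
    have [y' val_y' def_gF] := gE F FK; rewrite def_gF.
    by rewrite (_ : y' = y) //; apply: val_inj; rewrite val_y'.
  case=> F FS ->; have FK := sphere_ball FS.
  have [y val_y def_gF] := gE F FK; exists y; last by rewrite val_y.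
  by rewrite -def_gF (boundary_ball_sphere disAR A0 modG FK).
split=> //; last exact: partW modG; last first.
  by rewrite -cardAR; exact: (rank_susp_top disAR A0 R0 modG).
split.
- exact: near_eulerian_ball modG.
- by rewrite -cardAR; exact: (rank_ball_top disAR A0 modG).
- rewrite facesE closC; apply/setP=> x; rewrite in_setU.
  apply/imsetP/orP=> [[F FK ->]|[xC|/imsetP[F FS ->]]]; last first.
  + by exists F; rewrite // sphere_ball.
  + have [F FS def_x] := in_C x xC; exists F => //.
    move: xC; rewrite def_x memC // in_ball eqAR FS => /andP[RF].
    by apply: contra => AF; rewrite eqEsubset FS -eqAR subUset AF.
  have FS := sub_ball F FK; move: (FK); rewrite in_ball => /andP[FAR AF].
  have [RF|RF] := boolP (R \subset F); [left|right].
    rewrite memC // RF; apply: contra AF => /eqP->; exact: subsetDl.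
  by rewrite imset_f // in_sphere FAR AF.
rewrite facesE disjoints_subset; apply/subsetP=> x xC.
have [F FS def_x] := in_C x xC; move: xC; rewrite def_x memC // => /andP[RF _].
rewrite in_setC; apply/imsetP=> -[F' F'S] /(simplex_inj simS).
rewrite !powersetE FS sub_ball ?sphere_ball // => eqFF'.
by move: F'S; rewrite in_sphere -eqFF' // RF !andbF.
Qed.

(** Uniqueness of the initial coatom holds because only one class contains the
    bottom; for the same reason the other intervals have nonempty [R].  The last
    condition, which makes the terminal coatom unique, leaves [R != S] for the
    ordinary coatoms. *)
Lemma S_partition_of_intervals (T : finTPOrderType disp) (P : T -> {set T})
    (s1 st : T) d :
  eulerian T -> poset_rank T = d.+1 -> (0 < d)%N -> coatom_partition P ->
  coatom s1 -> P s1 = down s1 -> S_partitionable (adjoin_top (bdown s1)) ->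
  poset_rank (adjoin_top (bdown s1)) = d ->
  coatom st -> P st = [set st] -> susp_partitionable d ->
  (forall s, coatom s -> s != s1 -> exists (h : {set W} -> T) (R S : {set W}),
     [/\ simplex_at h S, s = h S, R \subset S, P s = h @: face_interval R S
       & R = S -> s = st]) ->
  S_partition P s1.
Proof.
move=> eulT rkT d_gt0 partP co_s1 Ps1 bd_s1 rk_s1 co_st Pst partW ord.
have [[[b b_min] _] _] := eulT; have [P_sub P_dis P_cov] := partP.
have rk_co (s : T) : coatom s -> rank s = d.
  by move=> /eqP rk_s; apply: succn_inj; rewrite rk_s.
have rk_b : rank b = 0%N.
  by apply/eqP; rewrite -leqn0; apply: rank_leq => y /lt_geF; rewrite b_min.
have b_unique (s : T) : coatom s -> b \in P s -> s = s1.
  move=> co_s bPs; apply/eqP/negPn/negP=> neq_s.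
  by have := disjointFr (P_dis s s1 co_s co_s1 neq_s) bPs; rewrite Ps1 inE b_min.
apply: (S_partition_intro (d := d) (st := st)) => //.
- split=> // s [co_s Ps]; apply/esym/b_unique => //.
  by rewrite Ps inE.
- split=> // s [co_s Ps]; have [eq_s|neq_s] := eqVneq s s1.
    have : b \in P s by rewrite eq_s Ps1 inE.
    rewrite Ps in_set1 => /eqP eq_b; move: (rk_co s co_s).
    by rewrite -eq_b rk_b => d0; rewrite -d0 in d_gt0.
  have [h [R [S [simS def_s RS PsE RS_st]]]] := ord s co_s neq_s.
  apply/esym/RS_st; have : h R \in P s by rewrite PsE imset_f // in_set subxx RS.
  rewrite Ps in_set1 def_s => /eqP /(simplex_inj simS).
  by rewrite !powersetE; apply.
move=> s co_s neq_s1 neq_st.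
have [h [R [S [simS def_s RS PsE RS_st]]]] := ord s co_s neq_s1.
have cardS : #|S| = d by rewrite -(rank_simplex simS (subxx S)) -def_s rk_co.
rewrite -cardS; apply: (interval_class simS RS); rewrite ?cardS //.
- apply: contra neq_s1 => /eqP R0; apply/eqP/b_unique => //.
  have [F FS def_b] := simplex_below simS (subxx S) (b_min (h S)).
  have -> : b = h set0.
    by apply/eqP; rewrite eq_le b_min def_b (simplex_le simS) ?sub0set.
  by rewrite PsE imset_f // in_set R0 !sub0set.
- by apply: contra neq_st => /eqP /RS_st->.
by rewrite PsE def_s.
Qed.

End Classes.

(** * Partitions indexed by facets *)

Section IntervalClasses.
Context {disp : Order.disp_t} {W : finType} {T : finTPOrderType disp} {I : finType}.
Implicit Types (F : {set W}) (i j : I) (x s : T).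
Variables (h : {set W} -> T) (J : {set I}) (R S : I -> {set W}).

(** An index is the omitted vertex for a ball, the pair of omitted vertices for a
    sphere, and the facet itself for a complex.  The union has at most one term
    when the facets [S i] are distinct: it finds the index of [s]. *)
Definition interval_classes s : {set T} :=
  \bigcup_(i in J | s == h (S i)) h @: face_interval (R i) (S i).

Lemma interval_classesP x s :
  reflect (exists i F, [/\ i \in J, s = h (S i), F \in face_interval (R i) (S i) & x = h F])
    (x \in interval_classes s).
Proof.
apply: (iffP bigcupP) => [[i /andP[iJ /eqP->] /imsetP[F FI ->]]|].
  by exists i, F.
case=> i [F [iJ -> FI ->]]; exists i; first by rewrite iJ eqxx.
exact: imset_f.
Qed.

Variable K : {set {set W}}.
Hypotheses (h_inj : {in K &, injective h}) (SK : {in J, forall i, S i \in K}).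
Hypothesis sub_K : forall i F, i \in J -> F \in face_interval (R i) (S i) -> F \in K.
Hypothesis RS : {in J, forall i, R i \subset S i}.
Hypothesis unique_class : forall i j F, i \in J -> j \in J ->
  F \in face_interval (R i) (S i) -> F \in face_interval (R j) (S j) -> i = j.

Lemma facet_in_interval i : i \in J -> S i \in face_interval (R i) (S i).
Proof. by move=> iJ; rewrite in_set RS // subxx. Qed.

Lemma facet_inj i j : i \in J -> j \in J -> h (S i) = h (S j) -> i = j.
Proof.
move=> iJ jJ /h_inj eqS; apply: (unique_class iJ jJ (facet_in_interval iJ)).
by rewrite eqS ?SK // facet_in_interval.
Qed.

Lemma interval_classes_facet i : i \in J ->
  interval_classes (h (S i)) = h @: face_interval (R i) (S i).
Proof.
move=> iJ; apply/setP=> x; apply/interval_classesP/imsetP.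
  by case=> j [F [jJ /facet_inj eq_ij FI ->]]; exists F; rewrite // eq_ij.
by case=> F FI ->; exists i, F.
Qed.

Lemma interval_classes_disjoint s t : s != t ->
  [disjoint interval_classes s & interval_classes t].
Proof.
move=> neq_st; rewrite disjoints_subset; apply/subsetP=> x.
case/interval_classesP=> i [F [iJ def_s Fi def_x]]; rewrite in_setC.
apply/interval_classesP=> -[j [F' [jJ def_t Fj]]]; rewrite def_x => eqh.
have eqF := h_inj (sub_K iJ Fi) (sub_K jJ Fj) eqh; rewrite -eqF in Fj.
by move: neq_st; rewrite def_s def_t (unique_class iJ jJ Fi Fj) eqxx.
Qed.

End IntervalClasses.

Section ModelPartition.
Context {disp : Order.disp_t} {W : finType} {T : finTPOrderType disp} {I : finType}.
Variables (K : {set {set W}}) (g : {set W} -> T) (J : {set I}) (R S : I -> {set W}).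
Hypotheses (modT : face_model K g) (SK : {in J, forall i, S i \in K}).
Hypothesis sub_K : forall i F, i \in J -> F \in face_interval (R i) (S i) -> F \in K.
Hypothesis RS : {in J, forall i, R i \subset S i}.
Hypothesis unique_class : forall i j F, i \in J -> j \in J ->
  F \in face_interval (R i) (S i) -> F \in face_interval (R j) (S j) -> i = j.
Hypothesis some_class : forall F, F \in K ->
  exists2 i, i \in J & F \in face_interval (R i) (S i).
Hypothesis coatomS : forall i, i \in J -> coatom (g (S i)).
Hypothesis coatom_cases : forall x, coatom x -> exists2 i, i \in J & x = g (S i).

Lemma model_class i : i \in J ->
  interval_classes g J R S (g (S i)) = g @: face_interval (R i) (S i).
Proof.
exact: interval_classes_facet (model_inj modT) SK RS unique_class i.
Qed.

Lemma model_coatom_partition : coatom_partition (interval_classes g J R S).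
Proof.
split=> [s|s t _ _|].
- case/coatom_cases=> i iJ ->; rewrite model_class //.
  apply/subsetP=> _ /imsetP[F FI ->].
  rewrite in_set (model_le modT) ?SK ?(sub_K iJ) //.
  by move: FI; rewrite in_set => /andP[].
- exact: interval_classes_disjoint (model_inj modT) sub_K unique_class s t.
apply/setP=> x; rewrite in_setC in_set1; apply/bigcupP/idP=> [[s]|].
  case/coatom_cases=> i iJ ->; rewrite model_class // => /imsetP[F FI ->].
  by case: modT => ntop _ _; apply: ntop; apply: sub_K FI.
case: (model_cases modT x) => [->|[F FK ->] _]; first by rewrite eqxx.
have [i iJ FI] := some_class FK; exists (g (S i)); first exact: coatomS.
by rewrite model_class // imset_f.
Qed.

End ModelPartition.

(** * The boundary of a simplex as a sphere *)

Section SimplexBoundary.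
Context {disp : Order.disp_t} {T : finTPOrderType disp} {W : finType}.
Variables (h : {set W} -> T) (S : {set W}) (w : W).
Hypotheses (simS : simplex_at h S) (wS : w \notin S) (S0 : S != set0).

Lemma simplex_boundary_sphere F : (F \in sphere S [set w]) = (F \proper S).
Proof.
rewrite in_sphere sub1set properE; apply/and3P/andP=> [[FSw SF wF]|[FS SF]].
  by rewrite SF -(subset_setU1_notin S wF) setUC.
split=> //; first by rewrite (subset_trans FS) ?subsetUl.
by apply: contra wS; apply: (subsetP FS).
Qed.

Lemma simplex_boundary_model : face_model (sphere S [set w])
  (fun F => insub (h F) : adjoin_top (bdown (h S))).
Proof.
apply: face_model_adjoin => [F F'|].
  rewrite !simplex_boundary_sphere => /proper_sub FS /proper_sub F'S.
  exact: (simplex_le simS).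
apply/setP=> x; rewrite in_setD1 in_set; apply/andP/imsetP; last first.
  case=> F; rewrite simplex_boundary_sphere => FS ->.
  move: FS (proper_sub FS) => + FS.
  by rewrite -(simplex_lt simS FS (subxx S)) lt_neqAle => /andP.
case=> neqx /(simplex_below simS (subxx S))[F FS def_x]; exists F => //.
rewrite simplex_boundary_sphere properEneq FS andbT.
by apply: contra neqx => /eqP eqFS; rewrite def_x eqFS.
Qed.

Lemma simplex_boundary_disjoint : [disjoint S & [set w]].
Proof. by rewrite disjoint_sym disjoints1. Qed.

Lemma set1_neq0 : [set w] != set0.
Proof. by rewrite -card_gt0 cards1. Qed.

Lemma rank_simplex_boundary : poset_rank (adjoin_top (bdown (h S))) = #|S|.
Proof.
rewrite (rank_model_top simplex_boundary_model (complex_sphere S0 set1_neq0)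
  (pure_sphere simplex_boundary_disjoint)).
by rewrite cards1 addn1 prednK // card_gt0.
Qed.

Lemma simplex_boundary_partitionable : @sphere_partitionable disp W #|S|.+1 ->
  S_partitionable (adjoin_top (bdown (h S))).
Proof.
move/(_ _ _ _ _ simplex_boundary_disjoint S0 set1_neq0); apply.
  by rewrite cards1 addn1.
exact: simplex_boundary_model.
Qed.

End SimplexBoundary.

(** * The first vertex missing from a face *)

Section FirstMissing.
Context {W : finType}.
Implicit Types (A F : {set W}) (a : W).

(** The predecessors of [a] in [A], for the enumeration order of the type. *)
Definition before A a : {set W} :=
  [set x in A | (enum_rank x < enum_rank a)%N].

Lemma first_missing A F : ~~ (A \subset F) ->
  exists a, [/\ a \in A, a \notin F & before A a \subset F].
Proof.
case/subsetPn=> a0 a0A a0F.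
pose Q := [pred x | (x \in A) && (x \notin F)].
have Qa0 : Q a0 by rewrite /= a0A.
case: (arg_minnP (fun x => enum_rank x : nat) Qa0) => a /andP[aA aF] a_min.
exists a; split=> //; apply/subsetP=> x; rewrite inE => /andP[xA].
rewrite ltnNge; apply: contraR => xF; apply: a_min.
by rewrite /= xA.
Qed.

Lemma first_missing_unique A F a a' :
  a \in A -> a' \in A -> a \notin F -> a' \notin F ->
  before A a \subset F -> before A a' \subset F -> a = a'.
Proof.
move=> aA a'A aF a'F /subsetP ltaF /subsetP lta'F; apply: enum_rank_inj.
apply: val_inj; case: (ltngtP (enum_rank a) (enum_rank a')) => // lt.
  by case/negP: aF; apply: lta'F; rewrite inE aA.
by case/negP: a'F; apply: ltaF; rewrite inE a'A.
Qed.

Lemma before_sub A a : before A a \subset A :\ a.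
Proof.
apply/subsetP=> x; rewrite !inE => /andP[xA lt_xa]; rewrite xA andbT.
by apply: contraTneq lt_xa => ->; rewrite ltnn.
Qed.

Lemma last_exists A : A != set0 -> exists2 l, l \in A & before A l = A :\ l.
Proof.
case/set0Pn=> a0 a0A.
case: (arg_maxnP (fun x => enum_rank x : nat) a0A) => l lA l_max.
exists l => //; apply/eqP; rewrite eqEsubset before_sub /=; apply/subsetP=> x.
rewrite !inE => /andP[neq_xl xA]; rewrite xA ltn_neqAle.
have -> : (enum_rank x <= enum_rank l)%N by apply: l_max.
rewrite andbT.
by apply: contra neq_xl => /eqP/val_inj/enum_rank_inj ->.
Qed.

Lemma last_unique A a l : a \in A -> l \in A ->
  before A a = A :\ a -> before A l = A :\ l -> a = l.
Proof.
move=> aA lA /setP/(_ l) la /setP/(_ a) al; apply/eqP/negPn/negP=> neq.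
move: la al; rewrite !inE aA lA eq_sym neq /= => lt1 lt2.
by have := ltn_trans lt1 lt2; rewrite ltnn.
Qed.

End FirstMissing.

(** * S-partitions of suspended balls and of spheres *)

Section Steps.
Context {disp : Order.disp_t} {W : finType}.
Implicit Types (A B F : {set W}).

(** Faces in the boundary go to the added coatom; the other faces contain [B] and go
    to the facet omitting the first vertex of [A] that they miss.  The facets have
    [n.-1] vertices, and the boundary of the added coatom is a sphere on the same
    [n] vertices. *)
Lemma susp_step n : @sphere_partitionable disp W n ->
  @susp_partitionable disp W n.-1 -> @susp_partitionable disp W n.
Proof.
move=> sphn suspn A B T g disAB A0 B0 cardAB modT.
have n_gt1 : (1 < n)%N by rewrite -cardAB; move: A0 B0; rewrite -!card_gt0; lia.
pose h := susp_face g; pose S a := (A :|: B) :\ a; pose R a := B :|: before A a.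
pose P (u : semisuspension T) :=
  if u == added_coatom then down added_coatom else interval_classes h A R S u.
have h_inj : {in ball A B &, injective h} := susp_face_inj modT.
have SK : {in A, forall a, S a \in ball A B} by move=> a; apply: mem_ball_facet.
have notinB a : a \in A -> a \notin B by move=> aA; rewrite (disjointFr disAB).
have inI a F : F \in face_interval (R a) (S a) ->
    [/\ B \subset F, F \subset A :|: B, a \notin F & before A a \subset F].
  by rewrite in_set subUset subsetD1 => /andP[/andP[-> ->] /andP[-> ->]].
have sub_K a F : a \in A -> F \in face_interval (R a) (S a) -> F \in ball A B.
  move=> aA /inI[_ FAB aF _]; rewrite in_ball FAB.
  by apply: contra aF => /subsetP; apply.
have RS : {in A, forall a, R a \subset S a}.
  move=> a aA; rewrite subsetD1 !subUset subsetUr in_setU negb_or notinB //=.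
  have := before_sub A a; rewrite subsetD1 => /andP[bA ->]; rewrite andbT.
  exact: subset_trans bA (subsetUl _ _).
have uniqI a a' F : a \in A -> a' \in A -> F \in face_interval (R a) (S a) ->
    F \in face_interval (R a') (S a') -> a = a'.
  by move=> aA a'A /inI[_ _ aF ltF] /inI[_ _ a'F ltF']; apply: first_missing_unique ltF ltF'.
have nadd F : (h F == added_coatom) = false by [].
have Padd : P added_coatom = down added_coatom by rewrite /P eqxx.
have PS a : a \in A -> P (h (S a)) = h @: face_interval (R a) (S a).
  by move=> aA; rewrite /P nadd; apply: interval_classes_facet h_inj SK RS uniqI _ aA.
have rk_add := rank_added disAB A0 B0 modT.
have rk_top := rank_susp_top disAB A0 B0 modT.
have rk_face := rank_susp_face A0 modT.
have co_add : coatom (added_coatom : semisuspension T).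
  by rewrite /coatom rk_add rk_top cardAB; apply/eqP; lia.
have co_S a : a \in A -> coatom (h (S a)).
  move=> aA; rewrite /coatom rk_face ?SK // rk_top.
  by rewrite (card_ball_facet disAB aA).
have co_cases u : coatom u -> u = added_coatom \/ exists2 a, a \in A & u = h (S a).
  case: (susp_cases modT u) => [->|->|[F FK ->]]; last 1 first.
  - rewrite /coatom rk_face // rk_top => /eqP cardF; right.
    have [a aA FS] := sub_ball_facet FK; exists a => //; congr h; apply/eqP.
    by rewrite eqEcard FS -ltnS (card_ball_facet disAB aA) cardF /=.
  - by rewrite /coatom gtn_eqF ?ltnSn.
  by left.
have face_le F : F \in ball A B -> (h F <= added_coatom) = (F \in sphere A B).
  exact: susp_face_le_added.
have partP : coatom_partition P.
  (* a face in the class of a facet contains [B], so it is not in the boundary *)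
  have dis_add a : a \in A -> [disjoint P added_coatom & P (h (S a))].
    move=> aA; rewrite Padd PS // disjoint_sym disjoints_subset.
    apply/subsetP=> _ /imsetP[F FI ->]; rewrite in_setC in_set face_le ?(sub_K a) //.
    by have [BF _ _ _] := inI a F FI; rewrite in_sphere BF !andbF.
  split=> [s|s t|].
  - case/co_cases=> [->|[a aA ->]]; first by rewrite Padd.
    rewrite PS //; apply/subsetP=> _ /imsetP[F FI ->].
    rewrite in_set (susp_face_le modT) ?SK ?(sub_K a) //.
    by move: FI; rewrite in_set => /andP[].
  - case/co_cases=> [->|[a aA ->]] /co_cases[->|[a' a'A ->]] neq.
    + by rewrite eqxx in neq.
    + exact: dis_add.
    + by rewrite disjoint_sym; apply: dis_add.
    by rewrite /P !nadd; apply: interval_classes_disjoint h_inj sub_K uniqI _ _ neq.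
  apply/setP=> u; rewrite in_setC in_set1; apply/bigcupP/idP=> [[s]|].
    case/co_cases=> [->|[a aA ->]].
      rewrite Padd in_set => leu; apply: contraTneq leu => ->.
      by rewrite (lt_geF (added_lt_top T)).
    rewrite PS // => /imsetP[F FI ->].
    by rewrite (lt_eqF (susp_face_lt_top modT _)) ?(sub_K a).
  case: (susp_cases modT u) => [->|->|[F FK ->]]; first by rewrite eqxx.
    by exists added_coatom => //; rewrite Padd in_set.
  move=> _; move: (FK); rewrite in_ball => /andP[FAB AF].
  have [BF|BF] := boolP (B \subset F); last first.
    by exists added_coatom => //; rewrite Padd in_set face_le // in_sphere FAB AF.
  have [a [aA aF ltF]] := first_missing AF.
  exists (h (S a)); first exact: co_S.
  by rewrite PS // imset_f // in_set subUset BF ltF subsetD1 FAB.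
(* the terminal facet omits the last vertex of [A] *)
have [l lA last_l] := last_exists A0.
have RS_last a : a \in A -> R a = S a -> before A a = A :\ a.
  move=> aA /setP eqRS; apply/setP=> x; have := eqRS x.
  rewrite [x \in R a]in_setU [x \in S a]in_setD1 in_setU in_setD1.
  have [xB|] := boolP (x \in B); last by rewrite orbF.
  rewrite (disjointFl disAB xB) andbF => _; apply/negbTE/negP=> /(subsetP (before_sub A a)).
  by rewrite in_setD1 (disjointFl disAB xB) andbF.
have bd_add : bdown (added_coatom : semisuspension T) = h @: sphere A B.
  apply/setP=> u; rewrite in_setD1 in_set; apply/andP/imsetP; last first.
    by case=> F FS ->; rewrite nadd face_le ?sphere_ball.
  case: (susp_cases modT u) => [->|->|[F FK ->]] [].
  - by rewrite (lt_geF (added_lt_top T)).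
  - by rewrite eqxx.
  by rewrite face_le // => _ FS; exists F.
have modS : face_model (sphere A B) (fun F => insub (h F) : adjoin_top (bdown added_coatom)).
  apply: face_model_adjoin bd_add => F F' /sphere_ball FK /sphere_ball F'K.
  exact: (susp_face_le modT FK F'K).
exists P; apply: (S_partition_of_intervals (W := W) (d := n.-1) (st := h (S l))) => //.
- exact: eulerian_susp modT.
- by rewrite [LHS]rk_top cardAB prednK // ltnW.
- by rewrite -ltnS prednK // ltnW.
- exact: sphn modS.
- rewrite (rank_model_top modS (complex_sphere A0 B0) (pure_sphere disAB)) cardAB; lia.
- exact: co_S.
- rewrite PS // (_ : face_interval _ _ = [set S l]) ?imset_set1 //.
  have -> : R l = S l.
    rewrite /R last_l /S; apply/setP=> x; rewrite !inE.
    by case: eqP => [->|_] /=; rewrite ?(negPf (notinB l lA)) // orbC.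
  by apply/setP=> F; rewrite in_set in_set1 eqEsubset andbC.
move=> s co_s neq_s; case: (co_cases s co_s) => [eq_s|[a aA ->]].
  by rewrite eq_s eqxx in neq_s.
exists h, (R a), (S a); split; rewrite ?PS ?RS //.
  by apply: (simplex_susp A0 modT); apply: SK.
by move/(RS_last a aA)=> last_a; rewrite (last_unique aA lA last_a last_l).
Qed.

End Steps.

Section SphereStep.
Context {disp : Order.disp_t} {W : finType}.
Implicit Types (A B F : {set W}).

(** Faces go to the facet omitting the first vertex of [A] and the first vertex of
    [B] that they miss.  The facets have [n.-2] vertices; the boundary of the
    initial one is a sphere on its own vertices and one more, for which the vertex
    of [A] that it omits is available.  A facet is alone in its class when both
    omitted vertices are last. *)
Lemma sphere_step n : (2 < n)%N -> @sphere_partitionable disp W n.-1 ->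
  @susp_partitionable disp W n.-2 -> @sphere_partitionable disp W n.
Proof.
move=> n_gt2 sphn suspn A B T g disAB A0 B0 cardAB modT.
have [d_gt0 predSn1] : (0 < n.-2)%N /\ n.-2.+1 = n.-1 by split; lia.
pose J := setX A B.
pose S (p : W * W) := (A :|: B) :\ p.1 :\ p.2.
pose R (p : W * W) := before A p.1 :|: before B p.2.
have JP p : p \in J -> p.1 \in A /\ p.2 \in B by rewrite inE => /andP.
have complexK := complex_sphere A0 B0; have pureK := pure_sphere disAB.
have SK : {in J, forall p, S p \in sphere A B}.
  by move=> p /JP[aA bB]; apply: mem_sphere_facet.
have inI p F : F \in face_interval (R p) (S p) ->
    [/\ before A p.1 \subset F, before B p.2 \subset F, F \subset A :|: B,
        p.1 \notin F & p.2 \notin F].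
  rewrite in_set subUset !subsetD1.
  by case/andP=> /andP[-> ->] /andP[/andP[-> ->] ->].
have sub_K p F : p \in J -> F \in face_interval (R p) (S p) -> F \in sphere A B.
  case/JP=> aA bB /inI[_ _ FAB aF bF]; rewrite in_sphere FAB /=.
  apply/andP; split; first by apply: contra aF => /subsetP; apply.
  by apply: contra bF => /subsetP; apply.
have RS : {in J, forall p, R p \subset S p}.
  case=> a b /JP[/= aA bB]; rewrite !subsetD1 !subUset !in_setU /=.
  have := before_sub A a; rewrite subsetD1 => /andP[bef_aA a_bef].
  have := before_sub B b; rewrite subsetD1 => /andP[bef_bB b_bef].
  rewrite (subset_trans bef_aA) ?subsetUl // (subset_trans bef_bB) ?subsetUr //.
  rewrite (negPf a_bef) (negPf b_bef) orbF /=; apply/andP; split.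
    by apply: contraTN aA => /(subsetP bef_bB) aB; rewrite (disjointFl disAB aB).
  by apply: contraTN bB => /(subsetP bef_aA) bA; rewrite (disjointFr disAB bA).
have uniqI p q F : p \in J -> q \in J -> F \in face_interval (R p) (S p) ->
    F \in face_interval (R q) (S q) -> p = q.
  case: p q => [a b] [a' b'] /JP[/= aA bB] /JP[/= a'A b'B].
  case/inI=> ltaF ltbF _ aF bF /inI[/= lta'F ltb'F _ a'F b'F].
  by congr (_, _); [apply: first_missing_unique ltaF lta'F
                   |apply: first_missing_unique ltbF ltb'F].
have some_class F : F \in sphere A B ->
    exists2 p, p \in J & F \in face_interval (R p) (S p).
  rewrite in_sphere => /and3P[FAB AF BF].
  have [a [aA aF ltaF]] := first_missing AF.
  have [b [bB bF ltbF]] := first_missing BF.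
  exists (a, b); first by rewrite inE aA.
  by rewrite in_set subUset /= ltaF ltbF !subsetD1 FAB aF bF.
have rk_top : rank (\top : T) = n.-1.
  by rewrite [LHS](rank_model_top modT complexK pureK) cardAB.
have rk_g F : F \in sphere A B -> rank (g F) = #|F|.
  exact: rank_model modT complexK _.
have cardS p : p \in J -> #|S p| = n.-2.
  by move=> /JP[aA bB]; rewrite -cardAB -(card_sphere_facet disAB aA bB).
have co_S p : p \in J -> coatom (g (S p)).
  by move=> pJ; rewrite /coatom rk_g ?SK // rk_top cardS // predSn1.
have co_cases x : coatom x -> exists2 p, p \in J & x = g (S p).
  case: (model_cases modT x) => [->|[F FK ->]].
    by rewrite /coatom gtn_eqF ?ltnSn.
  rewrite /coatom rk_g // rk_top => /eqP cardF.
  have [a [b [aA bB FS]]] := sub_sphere_facet FK.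
  have abJ : (a, b) \in J by rewrite inE aA.
  exists (a, b) => //; congr g; apply/eqP; rewrite eqEcard FS cardS //=.
  by rewrite -ltnS cardF predSn1.
have PS := model_class modT SK RS uniqI.
have partP := model_coatom_partition modT SK sub_K RS uniqI some_class co_S co_cases.
(* the initial facet is the one that receives the empty face *)
have [p1 p1J /inI[bef_a bef_b _ _ _]] := some_class _ complexK.1.
move: bef_a bef_b; rewrite !subset0 => /eqP bef_a /eqP bef_b.
have [l lA last_l] := last_exists A0; have [m mB last_m] := last_exists B0.
have [p1A p1B] := JP p1 p1J.
have p1S : p1.1 \notin S p1 by rewrite !inE eqxx andbF.
have S1_0 : S p1 != set0 by rewrite -card_gt0 cardS.
have simS1 := simplex_model modT complexK (SK p1 p1J).
apply: S_partitionable_step.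
apply: (S_partition_of_intervals (W := W) (d := n.-2) (s1 := g (S p1))
  (st := g (S (l, m))) _ _ _ partP) => //.
- exact: eulerian_sphere modT.
- by rewrite [LHS]rk_top.
- exact: co_S.
- rewrite PS //; apply/setP=> x; rewrite [RHS]in_set; apply/imsetP/idP.
    case=> F FI ->; rewrite (model_le modT) ?SK ?(sub_K p1) //.
    by move: FI; rewrite in_set => /andP[].
  case/(model_below modT (SK p1 p1J))=> F [FK FS def_x]; exists F => //.
  by rewrite in_set FS andbT /R bef_a bef_b setU0 sub0set.
- by apply: (simplex_boundary_partitionable simS1 p1S S1_0); rewrite cardS // predSn1.
- by rewrite (rank_simplex_boundary simS1 p1S S1_0) cardS.
- by apply: co_S; rewrite inE lA.
- have lmJ : (l, m) \in J by rewrite inE lA.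
  have RSlm : R (l, m) = S (l, m).
    rewrite /R /S /= last_l last_m; apply/setP=> x; rewrite !inE.
    have [xA|xA] := boolP (x \in A).
      by rewrite (disjointFr disAB xA) andbF !orbF (disjoint_neq disAB xA mB).
    rewrite andbF /=; case xB: (x \in B); rewrite ?andbF ?andbT //.
    by rewrite [x == l]eq_sym (disjoint_neq disAB lA xB) andbT.
  rewrite PS // RSlm (_ : face_interval _ _ = [set S (l, m)]) ?imset_set1 //.
  by apply/setP=> F; rewrite in_set in_set1 eqEsubset andbC.
move=> s co_s _; have [[a b] pJ ->] := co_cases s co_s.
have [/= aA bB] := JP _ pJ.
exists g, (R (a, b)), (S (a, b)); split; rewrite ?PS ?RS //.
  exact: (simplex_model modT complexK (SK _ pJ)).
move=> /setP eqRS; suff [-> ->] : a = l /\ b = m by [].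
split.
  apply: (last_unique aA lA _ last_l); apply/setP=> x; have := eqRS x.
  rewrite /R /S /= [LHS]in_setU [RHS]in_setD1 !in_setD1 in_setU.
  have [xA|xA] := boolP (x \in A).
    rewrite (disjoint_neq disAB xA bB) andbT /= => <-.
    suff -> : x \in before B b = false by rewrite orbF.
    by rewrite inE (disjointFr disAB xA).
  by move=> _; rewrite inE (negPf xA) andbF.
apply: (last_unique bB mB _ last_m); apply/setP=> x; have := eqRS x.
rewrite /R /S /= [LHS]in_setU [RHS]in_setD1 !in_setD1 in_setU.
have [xB|xB] := boolP (x \in B).
  rewrite orbT andbT [x == a]eq_sym (disjoint_neq disAB aA xB) andbT => <-.
  suff -> : x \in before A a = false by [].
  by rewrite inE (disjointFl disAB xB).
by move=> _; rewrite inE (negPf xB) andbF.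
Qed.

(** A sphere on [n] vertices needs spheres on [n.-1] and balls on [n.-2] vertices; a
    ball on [n] vertices needs spheres on [n] and balls on [n.-1] vertices.  The
    base case is [n = 2], where the only face of the sphere is the empty one. *)
Lemma spheres_partitionable n :
  @sphere_partitionable disp W n /\ @susp_partitionable disp W n.
Proof.
have [m] := ubnP n; elim: m n => // m IHm n; rewrite ltnS => le_nm.
have sizes A B : A != set0 -> B != set0 -> (1 < #|A| + #|B|)%N.
  by rewrite -!card_gt0; lia.
have [n_le1|n_gt1] := leqP n 1.
  by split=> A B T g _ A0 B0 cardAB; have := sizes A B A0 B0; rewrite cardAB ltnNge n_le1.
have [sph1 susp1] := IHm n.-1 ltac:(lia); have [_ susp2] := IHm n.-2 ltac:(lia).
suff sph : @sphere_partitionable disp W n by split=> //; apply: susp_step.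
move: n_gt1; rewrite leq_eqVlt => /predU1P[n2|n_gt2].
  move=> A B T g disAB A0 B0 cardAB modT; apply: S_partitionable_point.
    exact: eulerian_sphere modT.
  by rewrite (rank_model_top modT (complex_sphere A0 B0) (pure_sphere disAB)) cardAB -n2.
exact: sphere_step.
Qed.

End SphereStep.

(** * Face posets of partitioned complexes *)

Import Order.DefaultSetSubsetOrder.

Section FacePoset.
Context {V : finType}.
Variable D : {set {set V}}.
Hypotheses (complexD : simplicial_complex D) (gradedD : graded (face_poset D)).

Definition face (F : {set V}) : face_poset D := insub F.

Lemma face_poset_model : face_model D face.
Proof.
apply: (face_model_adjoin (h := id)); last by rewrite imset_id.
by [].
Qed.

Lemma sub_facet F : F \in D -> exists2 S, facet D S & F \subset S.
Proof. by case/(maxset_exists (P := mem D))=> S; exists S. Qed.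

Lemma facet_mem S : facet D S -> S \in D.
Proof. by case/maxsetP. Qed.

(** Nothing lies strictly between a facet and the top, so gradedness gives all
    facets the same number of vertices. *)
Lemma card_facet S : facet D S -> poset_rank (face_poset D) = #|S|.+1.
Proof.
move=> facS; have SD := facet_mem facS.
rewrite -(rank_model face_poset_model complexD SD); apply: gradedD.2.
rewrite /covers (model_lt_top face_poset_model) //; apply/forallP=> x.
case: (model_cases face_poset_model x) => [->|[F FD ->]]; first by rewrite ltxx andbF.
rewrite lt_neqAle (model_le face_poset_model) //.
have [SF|//] := boolP (S \subset F); last by rewrite andbF.
by have /maxsetP[_ /(_ F FD SF) ->] := facS; rewrite eqxx.
Qed.

Lemma coatom_facet S : facet D S -> coatom (face S).
Proof.
move=> facS; rewrite /coatom (rank_model face_poset_model) ?facet_mem //.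
by rewrite -(card_facet facS).
Qed.

Lemma coatom_faceP x : coatom x -> exists2 S, facet D S & x = face S.
Proof.
case: (model_cases face_poset_model x) => [->|[F FD ->]].
  by rewrite /coatom gtn_eqF ?ltnSn.
have [S facS FS] := sub_facet FD.
rewrite /coatom (rank_model face_poset_model) //.
move/eqP; rewrite [RHS](card_facet facS) => -[cardF].
by exists S; rewrite // (_ : F = S) //; apply/eqP; rewrite eqEcard FS cardF /=.
Qed.

(** Presenting the boundary of [S] as a sphere takes a point outside [S], which [V]
    need not have; [None] is such a point of [option V]. *)
Lemma lifted_simplex (S : {set V}) : S \in D ->
  simplex_at (fun X : {set option V} => face (Some @^-1: X)) (Some @: S).
Proof.
move=> SD; have pre_sub (X : {set option V}) : X \subset Some @: S -> X = Some @: (Some @^-1: X).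
  move=> XS; apply/setP=> -[x|]; last first.
    transitivity false; last by apply/esym/imsetP; case.
    by apply: contraTF XS => noneX; apply/subsetPn; exists None => //; apply/imsetP; case.
  by rewrite mem_imset ?inE //; apply: Some_inj.
have pre_S (X : {set option V}) : X \subset Some @: S -> Some @^-1: X \subset S.
  move=> /(preimsetS Some)/subset_trans; apply; apply/subsetP=> x; rewrite inE mem_imset //; apply: Some_inj.
have inD (X : {set option V}) : X \subset Some @: S -> Some @^-1: X \in D.
  by move/pre_S; apply: complexD.2 SD.
split=> [X Y|x].
  rewrite !powersetE => XS YS; rewrite (model_le face_poset_model) ?inD //.
  apply/idP/idP=> [|XY]; last exact: preimsetS.
  by move/(imsetS Some); rewrite -!pre_sub.
have SS : Some @^-1: (Some @: S) = S.
  by apply/setP=> y; rewrite inE mem_imset //; apply: Some_inj.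
rewrite SS => /(model_below face_poset_model SD)[F [FD FS ->]].
apply/imsetP; exists (Some @: F); first by rewrite powersetE imsetS.
by congr face; apply/setP=> y; rewrite inE mem_imset //; apply: Some_inj.
Qed.

End FacePoset.

Theorem theorem4p4 (V : finType) (D : {set {set V}})
    (complexD : simplicial_complex D) (partD : partitionable D)
    (semiD : semi_eulerian (face_poset D)) :
  SE_partitionable (face_poset D).
Proof.
split=> //; have gradedD := semiD.1.
have modD := face_poset_model D; have D0 := complexD.1.
have [R [R_sub R_part]] := partD.
have [S1 [[facS1 [R1 _]] _]] := R_part set0 D0.
have rkD := card_facet complexD gradedD facS1.
have [S1_0|S1_0] := eqVneq S1 set0; first by left; rewrite rkD S1_0 cards0.
right; pose J := [set S | facet D S].
have JD : {in J, forall S, S \in D} by move=> S; rewrite inE => /facet_mem.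
have RS : {in J, forall S, R S \subset S} by move=> S; rewrite inE => /R_sub.
have sub_D S F : S \in J -> F \in face_interval (R S) S -> F \in D.
  by rewrite !inE => /facet_mem SD /andP[_]; apply: complexD.2 SD.
have uniqI S S' F : S \in J -> S' \in J -> F \in face_interval (R S) S ->
    F \in face_interval (R S') S' -> S = S'.
  rewrite !inE => facS facS' /andP[RF FS] /andP[RF' FS'].
  have [S0 [_ uniqS]] := R_part F (complexD.2 _ _ (facet_mem facS) FS).
  by rewrite -(uniqS S) // (uniqS S').
have some_class F : F \in D -> exists2 S, S \in J & F \in face_interval (R S) S.
  by move/R_part=> [S [[facS [RF FS]] _]]; exists S; rewrite ?inE // RF.
have co_S S : S \in J -> coatom (face D S) by rewrite inE; apply: coatom_facet.
have co_cases x : coatom x -> exists2 S, S \in J & x = face D S.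
  by case/(coatom_faceP complexD gradedD) => S facS ->; exists S; rewrite ?inE.
pose P := interval_classes (face D) J R id.
have PS : forall S, S \in J -> P (face D S) = face D @: face_interval (R S) S.
  by move=> S SJ; apply: (model_class (S := id) modD JD RS uniqI SJ).
have S1J : S1 \in J by rewrite inE.
have PS1 : P (face D S1) = down (face D S1).
  rewrite PS //; apply/setP=> x; rewrite [RHS]in_set; apply/imsetP/idP.
    case=> F FI ->; rewrite (model_le modD (sub_D _ _ S1J FI) (JD _ S1J)).
    by move: FI; rewrite in_set => /andP[].
  case/(model_below modD (JD _ S1J))=> F [FD FS ->]; exists F => //.
  by rewrite in_set FS (subset_trans R1) ?sub0set.
have simS1 := lifted_simplex complexD (JD _ S1J).
have liftS1 : Some @^-1: (Some @: S1) = S1.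
  by apply/setP=> y; rewrite inE mem_imset //; apply: Some_inj.
have none_S1 : None \notin Some @: S1 by apply/imsetP; case.
have lift0 : Some @: S1 != set0 by rewrite -card_gt0 card_imset ?card_gt0 //; apply: Some_inj.
(* the ground set is [option V], with [None] as the point outside the facet *)
have bd_rank := rank_simplex_boundary simS1 none_S1 lift0.
have bd_part := simplex_boundary_partitionable simS1 none_S1 lift0
  (spheres_partitionable _).1.
rewrite liftS1 (card_imset _ Some_inj) in bd_rank bd_part.
(* the initial class is the only one containing the empty face *)
have class0 S : S \in J -> R S = set0 -> S = S1.
  move=> SJ RS0; apply: (uniqI S S1 set0) => //; rewrite in_set ?RS0 ?sub0set //.
  by rewrite R1.
exists P, #|S1|, (face D S1); split.
- exact: rkD.
- by rewrite card_gt0.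
- exact: model_coatom_partition modD JD sub_D RS uniqI some_class co_S co_cases.
- split=> //; split; first by split=> //; apply: co_S.
  move=> s [/co_cases[S SJ ->] PSd]; congr face; apply/esym/class0 => //.
  have : face D set0 \in P (face D S) by rewrite PSd in_set (model_bottom modD complexD).
  rewrite PS // => /imsetP[F FI /(model_inj modD) eqF].
  have F0 := eqF D0 (sub_D _ _ SJ FI); rewrite -F0 in_set subset0 in FI.
  by case/andP: FI => /eqP.
move=> s /co_cases[S SJ ->] neqS.
have cardS : #|S| = #|S1|.
  by apply: succn_inj; rewrite -rkD -(card_facet complexD gradedD) //; rewrite inE in SJ.
have [RS_eq|RS_neq] := eqVneq (R S) S.
  left; rewrite PS // (_ : face_interval _ _ = [set S]) ?imset_set1 // RS_eq.
  by apply/setP=> F; rewrite in_set in_set1 eqEsubset andbC.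
right; exists [set P (face D S) :\ face D S]; split.
- apply/and3P; split.
  + by rewrite /cover big_set1.
  + by apply/trivIsetP=> X Y; rewrite !in_set1 => /eqP-> /eqP->; rewrite eqxx.
  rewrite in_set1 eq_sym; apply/set0Pn; exists (face D (R S)).
  have RSI : R S \in face_interval (R S) S by rewrite in_set subxx RS.
  rewrite in_setD1 PS // imset_f // andbT; apply: contra RS_neq => /eqP.
  by move/(model_inj modD)=> ->; rewrite ?(sub_D _ _ SJ RSI) ?JD.
- by apply/set0Pn; exists (P (face D S) :\ face D S); rewrite in_set1.
move=> C; rewrite in_set1 => /eqP->; rewrite -cardS.
have simS := simplex_model modD complexD (JD _ SJ).
apply: (interval_class simS (RS _ SJ)) => //.
- by apply: contra neqS => /eqP /(class0 S SJ) ->.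
- exact: (spheres_partitionable _).2.
by rewrite PS.
Qed.
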